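(* Let $d\ge 1$ and $m$ be integers with $m>2d-1$, put $p=1/m$, let $\mathbf{F}_d$ be the free group with canonical generators $g_1,\dots,g_d$, and let $\Gamma=\mathcal{C}_m\wr\mathbf{F}_d$, where $\mathcal{C}_m$ is the cyclic group of order $m$. Let $\mathfrak{T}=\sum_{i=1}^d (g_i+g_i^{-1})\in\mathbf{Q}\mathbf{F}_d\subseteq\mathbf{Q}\Gamma$, let $E=\frac1m\sum_{h\in\mathcal{C}_m}h\in\mathbf{Q}\Gamma$, and let $\tilde{\mathfrak{T}}=E\,\mathfrak{T}\,E=\sum_{i=1}^d (E g_i E+E g_i^{-1}E)\in\mathbf{Q}\Gamma$ be the corresponding lamplighter operator, regarded as a left convolution operator on $\ell_2(\Gamma)$. Then the von Neumann dimension of the kernel of $\tilde{\mathfrak{T}}$ is $$\dim_{L(\Gamma)}\ker\tilde{\mathfrak{T}}=1-2p+\frac{(\tau(p)-1)\,(2-2d+2d\,\tau(p))}{\tau(p)^2},$$ where $\tau(p)$ is the unique positive solution $t$ of the equation $t^{2d-1}-t^{2d-2}=p$. For $d>1$ this is an irrational algebraic number. For example, for $d=2$ and $m=4$ the dimension is $$-\frac56-\frac{400}{3(766+258\sqrt{129})^{1/3}}+\frac{2(766+258\sqrt{129})^{1/3}}{3}\approx 0.850971.$$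
   Context: Wreath product: for a group $G$ and the cyclic group $\mathcal{C}_m$ of order $m$ with neutral element $e_{\mathcal{C}_m}$, let $\mathcal{L}=\bigoplus_G\mathcal{C}_m$ be the group (under pointwise multiplication) of functions $\eta:G\to\mathcal{C}_m$ with $\eta(x)=e_{\mathcal{C}_m}$ for all but finitely many $x$. $G$ acts on $\mathcal{L}$ by $L_g\eta(x)=\eta(g^{-1}x)$. Then $\mathcal{C}_m\wr G=\mathcal{L}\rtimes G$ is the set of pairs $(\eta,g)$ with multiplication $(\eta,g)(\eta',g')=(\eta\cdot L_g\eta',\,gg')$. Embeddings: $\mathcal{C}_m$ and $G$ are identified with subgroups of $\Gamma=\mathcal{C}_m\wr G$ via $h\mapsto(\delta_e^h,e)$ and $g\mapsto(\iota,g)$, where $\iota$ is the neutral element of $\mathcal{L}$, $\delta_e^h(e)=h$ and $\delta_e^h(x)=e_{\mathcal{C}_m}$ for $x\neq e$. Von Neumann dimension: for a discrete group $\Gamma$, an element of the rational group ring $\mathbf{Q}\Gamma$ acts as a bounded operator on $\ell_2(\Gamma)$ by left convolution. $L(\Gamma)$ is the group von Neumann algebra, i.e. the weak operator closure of the algebra of left convolution operators. It carries the faithful normal trace $\mathrm{tr}(a)=\langle a\delta_e,\delta_e\rangle$, where $e\in\Gamma$ is the neutral element. If $K\subseteq\ell_2(\Gamma)$ is a closed subspace whose orthogonal projection $P_K$ belongs to $L(\Gamma)$, then $\dim_{L(\Gamma)}K=\mathrm{tr}(P_K)$. For a self-adjoint element of $\mathbf{Q}\Gamma$, the projection onto the kernel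 of its convolution operator lies in $L(\Gamma)$. *)

(* Defs.v *)
From HB Require Import structures.
From mathcomp Require Import all_boot all_order all_algebra finmap.
From mathcomp Require Import monalg.
From mathcomp Require Import all_classical all_reals all_analysis.
From mathcomp Require Import complex ring.

Set Implicit Arguments.
Unset Strict Implicit.
Unset Printing Implicit Defensive.

Import Order.TTheory GRing.Theory Num.Theory.

Local Open Scope ring_scope.

(* The free group on X is the set of reduced words over X * bool, where
   (x, true) stands for the generator x and (x, false) for its inverse. *)
Section FreeGroup.
Variable X : choiceType.

Definition letter : Type := (X * bool)%type.
HB.instance Definition _ := Choice.on letter.

Definition letter_inv (a : letter) : letter := (a.1, ~~ a.2).

Definition reduced (w : seq letter) : bool :=
  sorted (fun a b => b != letter_inv a) w.

Record free_group := FreeGroup { word :> seq letter; _ : reduced word }.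
HB.instance Definition _ := [isSub for word].
HB.instance Definition _ := [Choice of free_group by <:].

(* Left multiplication of a reduced word by a letter. *)
Definition push (a : letter) (w : seq letter) : seq letter :=
  if w is b :: w' then if b == letter_inv a then w' else a :: w else [:: a].

Lemma letter_invK : involutive letter_inv.
Proof. by case=> x b; rewrite /letter_inv /= negbK. Qed.

Lemma push_reduced a w : reduced w -> reduced (push a w).
Proof.
case: w => [|b w] //= red_w; case: ifP => [_|ba].
  by case: w red_w => //= c w /andP[].
by rewrite /reduced /= ba.
Qed.

Lemma pushK a w : reduced w -> push a (push (letter_inv a) w) = w.
Proof.
case: w => [|b w] /= red_w; first by rewrite eqxx.
rewrite letter_invK; case: eqP => [<-|_] /=; last by rewrite eqxx.
by case: w red_w => [|c w] //= /andP[/negbTE ->].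
Qed.

Definition word_mul (u v : seq letter) : seq letter := foldr push v u.
Definition word_inv (u : seq letter) : seq letter := rev (map letter_inv u).

Lemma word_mul_reduced u v : reduced v -> reduced (word_mul u v).
Proof. by move=> red_v; elim: u => //= a u; exact: push_reduced. Qed.

Lemma word_inv_reduced u : reduced u -> reduced (word_inv u).
Proof.
rewrite /reduced /word_inv rev_sorted sorted_map.
by apply: sub_sorted => a b /=; rewrite letter_invK eq_sym.
Qed.

Lemma word_mulA u v w :
  reduced w -> word_mul u (word_mul v w) = word_mul (word_mul u v) w.
Proof.
move=> red_w; elim: u => //= a u ->.
case: (word_mul u v) => [|b t] //=; case: eqP => [->|_] //=.
by rewrite pushK //; exact: word_mul_reduced.
Qed.

Lemma word_mulw1 u : reduced u -> word_mul u [::] = u.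
Proof.
elim: u => //= a u IHu red_au; rewrite IHu; last exact: path_sorted red_au.
by case: u red_au {IHu} => //= b u /andP[/negbTE ->].
Qed.

Lemma word_mulVw u : reduced u -> word_mul (word_inv u) u = [::].
Proof.
elim: u => // a u IHu red_au; have red_u := path_sorted red_au.
rewrite /word_inv map_cons rev_cons /word_mul foldr_rcons /=.
by rewrite letter_invK eqxx; exact: IHu.
Qed.

Lemma word_invK : involutive word_inv.
Proof.
move=> u; rewrite /word_inv map_rev revK -map_comp.
by rewrite (eq_map (g := id)) ?map_id // => a; exact: letter_invK.
Qed.

Definition fg_one : free_group := @FreeGroup [::] isT.
Definition fg_mul (u v : free_group) : free_group :=
  FreeGroup (word_mul_reduced u (valP v)).
Definition fg_inv (u : free_group) : free_group :=
  FreeGroup (word_inv_reduced (valP u)).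

Lemma fg_mulA : associative fg_mul.
Proof. by move=> u v w; apply/val_inj/word_mulA/valP. Qed.
Lemma fg_mul1g : left_id fg_one fg_mul.
Proof. by move=> u; exact/val_inj. Qed.
Lemma fg_mulg1 : right_id fg_one fg_mul.
Proof. by move=> u; exact/val_inj/word_mulw1/valP. Qed.
Lemma fg_mulVg : left_inverse fg_one fg_inv fg_mul.
Proof. by move=> u; exact/val_inj/word_mulVw/valP. Qed.
Lemma fg_mulgV : right_inverse fg_one fg_inv fg_mul.
Proof.
move=> u; apply: val_inj; rewrite /= -{1}(word_invK u).
exact/word_mulVw/word_inv_reduced/valP.
Qed.

HB.instance Definition _ :=
  isGroup.Build free_group fg_mulA fg_mul1g fg_mulg1 fg_mulVg fg_mulgV.

Definition fg_gen (x : X) : free_group := @FreeGroup [:: (x, true)] isT.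

End FreeGroup.

Section Wreath.
Variables A G : groupType.

Definition lamps : Type := {fsfun G -> A with 1%g}.
HB.instance Definition _ := Choice.on lamps.

Definition lamps_one : lamps := [fsfun].

Definition lamps_mul (eta zeta : lamps) : lamps :=
  [fsfun x in (finsupp eta `|` finsupp zeta)%fset => (eta x * zeta x)%g].

Definition lamps_inv (eta : lamps) : lamps :=
  [fsfun x in finsupp eta => (eta x)^-1%g].

Definition lamps_shift (g : G) (eta : lamps) : lamps :=
  [fsfun x in [fset (g * y)%g | y in finsupp eta]%fset => eta (g^-1 * x)%g].

Definition lamps_delta (h : A) : lamps := [fsfun x in [fset 1%g]%fset => h].

Lemma lamps_oneE x : lamps_one x = 1%g.
Proof. by rewrite fsfun_dflt // finsupp0 inE. Qed.

Lemma lamps_mulE eta zeta x : lamps_mul eta zeta x = (eta x * zeta x)%g.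
Proof.
rewrite fsfunE in_fsetU; case: finsuppP => //= _; case: finsuppP => //= _.
by rewrite mulg1.
Qed.

Lemma lamps_invE eta x : lamps_inv eta x = (eta x)^-1%g.
Proof. by rewrite fsfunE; case: finsuppP; rewrite ?invg1. Qed.

Lemma lamps_shiftE g eta x : lamps_shift g eta x = eta (g^-1 * x)%g.
Proof.
rewrite fsfunE; case: imfsetP => // gx.
case: finsuppP => // supp_x; case: gx; exists (g^-1 * x)%g => //.
by rewrite mulVKg.
Qed.

Lemma lamps_deltaE h x : lamps_delta h x = if x == 1%g then h else 1%g.
Proof. by rewrite fsfunE in_fset1. Qed.

Definition wreath : Type := (lamps * G)%type.
HB.instance Definition _ := Choice.on wreath.

Definition wr_one : wreath := (lamps_one, 1%g).
Definition wr_mul (u v : wreath) : wreath :=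
  (lamps_mul u.1 (lamps_shift u.2 v.1), (u.2 * v.2)%g).
Definition wr_inv (u : wreath) : wreath :=
  (lamps_shift u.2^-1 (lamps_inv u.1), u.2^-1%g).

Let wrE := (lamps_oneE, lamps_mulE, lamps_invE, lamps_shiftE).

Lemma wr_mulA : associative wr_mul.
Proof.
move=> u v w; congr pair; rewrite /= ?mulgA //; apply/fsfunP => x.
by rewrite !wrE invgM !mulgA.
Qed.
Lemma wr_mul1g : left_id wr_one wr_mul.
Proof.
case=> eta g; congr pair; rewrite /= ?mul1g //; apply/fsfunP => x.
by rewrite !wrE invg1 !mul1g.
Qed.
Lemma wr_mulg1 : right_id wr_one wr_mul.
Proof.
case=> eta g; congr pair; rewrite /= ?mulg1 //; apply/fsfunP => x.
by rewrite !wrE mulg1.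
Qed.
Lemma wr_mulVg : left_inverse wr_one wr_inv wr_mul.
Proof.
case=> eta g; congr pair; rewrite /= ?mulVg //; apply/fsfunP => x.
by rewrite !wrE mulVg.
Qed.
Lemma wr_mulgV : right_inverse wr_one wr_inv wr_mul.
Proof.
case=> eta g; congr pair; rewrite /= ?mulgV //; apply/fsfunP => x.
by rewrite !wrE invgK mulVKg mulgV.
Qed.

HB.instance Definition _ :=
  isGroup.Build wreath wr_mulA wr_mul1g wr_mulg1 wr_mulVg wr_mulgV.

Definition wr_inl (h : A) : wreath := (lamps_delta h, 1%g).
Definition wr_inr (g : G) : wreath := (lamps_one, g).

End Wreath.

Section L2.
Variables (R : realType) (G : groupType).

Definition sqsummable : {pred G -> R[i]} :=
  fun f => `[< (\esum_(x in [set: G]) (Normc.normc (f x) ^+ 2)%:E < +oo)%E >].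

Lemma sqsummable_closed : submod_closed sqsummable.
Proof.
split; first apply/asboolP.
  rewrite esum1 ?ltry// => x _.
  have -> : Normc.normc ((0 : G -> R[i]) x) = 0 by exact: Normc.normc0.
  by rewrite expr0n.
move=> a u v /asboolP u2 /asboolP v2; apply/asboolP.
set c := 2 * Normc.normc a ^+ 2 + 2.
have c0 : 0 <= c by rewrite addr_ge0 // mulr_ge0 // sqr_ge0.
have sq0 f (x : G) : (0 <= (Normc.normc (f x : R[i]) ^+ 2)%:E)%E.
  by rewrite lee_fin sqr_ge0.
set w := fun x => ((Normc.normc (u x) ^+ 2)%:E + (Normc.normc (v x) ^+ 2)%:E)%E.
have w0 x : (0 <= w x)%E by rewrite adde_ge0.
apply: (@le_lt_trans _ _ (c%:E * \esum_(x in [set: G]) w x)%E); last first.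
  rewrite esumD //; apply: lte_mul_pinfty => //.
  by rewrite lte_add_pinfty.
apply: ge_ereal_sup => _ [A [finA _] <-].
apply: (@le_trans _ _ (\sum_(x \in A) (c%:E * w x))%E).
  apply: lee_fsum => // x _; rewrite /w -EFinD -EFinM lee_fin.
  have tri : Normc.normc ((a *: u + v) x)
             <= Normc.normc a * Normc.normc (u x) + Normc.normc (v x).
    by rewrite -Normc.normcM; exact: le_normcD.
  have n0 z : 0 <= Normc.normc (z : R[i]) by case: z => p q; exact: sqrtr_ge0.
  have := n0 a; have := n0 (u x); have := n0 (v x); move: tri (n0 ((a *: u + v) x)).
  rewrite /c; move: (Normc.normc _) (Normc.normc a) (Normc.normc (u x)).
  move: (Normc.normc (v x)) => p q r s qrs q0 p0 s0 r0.
  have rs0 : 0 <= r * s by rewrite mulr_ge0.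
  apply: (@le_trans _ _ ((r * s + p) ^+ 2)).
    by rewrite lerXn2r // nnegrE addr_ge0.
  rewrite -subr_ge0; set e := (X in 0 <= X).
  have -> : e = (r * s - p) ^+ 2 + 2 * s ^+ 2 + 2 * r ^+ 2 * p ^+ 2.
    by rewrite /e; ring.
  by do 2?apply: addr_ge0; rewrite ?sqr_ge0 ?mulr_ge0 ?sqr_ge0 ?ler0n.
rewrite -ge0_mule_fsumr //; apply: lee_wpmul2l; first by rewrite lee_fin.
by apply: ereal_sup_ubound; exists A.
Qed.

HB.instance Definition _ :=
  GRing.isSubmodClosed.Build R[i] (G -> R[i]) sqsummable sqsummable_closed.

Record l2 := L2 { l2fun :> G -> R[i]; _ : l2fun \in sqsummable }.
HB.instance Definition _ := [isSub for l2fun].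
HB.instance Definition _ := [Choice of l2 by <:].
HB.instance Definition _ := [SubChoice_isSubLmodule of l2 by <:].

End L2.

Section L2Theory.
Variables (R : realType) (G : groupType).
Local Notation l2 := (l2 R G).

(* Meaningful for absolutely summable u; compare esumB. *)
Definition rsum (u : G -> R) : R :=
  fine (\esum_(x in [set: G]) (EFin \o u)^\+%E x
        - \esum_(x in [set: G]) (EFin \o u)^\-%E x)%E.

Definition csum (u : G -> R[i]) : R[i] :=
  (rsum (fun x => complex.Re (u x)) +i* rsum (fun x => complex.Im (u x)))%C.

Definition l2dot (f g : l2) : R[i] := csum (fun x => f x * (g x)^*%C).

Definition l2norm (f : l2) : R := Num.sqrt (complex.Re (l2dot f f)).

Fact l2_delta_subproof :
  (fun x : G => (x == 1%g)%:R) \in @sqsummable R G.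
Proof.
apply/asboolP; rewrite (esumID [set 1%g]) => [|x _]; last first.
  by rewrite lee_fin sqr_ge0.
rewrite setTI esum_set1 ?lee_fin ?sqr_ge0 // esum1 ?adde0 ?ltry // => x [_ /eqP].
move=> /negbTE ->; have -> : Normc.normc (false%:R : R[i]) = 0.
  exact: Normc.normc0.
by rewrite expr0n.
Qed.

Definition l2_delta : l2 := L2 l2_delta_subproof.

Fact l2_shift_subproof (g : G) (f : l2) :
  (fun x => f (g^-1 * x)%g) \in @sqsummable R G.
Proof.
have /asboolP f2 := valP f; apply/asboolP; apply: le_lt_trans f2.
rewrite (reindex_esum [set: G] [set: G] (fun x : G => (g * x)%g)) //=.
  by apply: le_esum => x _; rewrite mulKg.
rewrite setTT_bijective; exists (fun x => (g^-1 * x)%g);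
  [exact: mulKg | exact: mulVKg].
Qed.

Definition l2_shift (g : G) (f : l2) : l2 := L2 (l2_shift_subproof g f).

(* Left convolution by an element a of the group ring K G, where iota maps the
   coefficients into the complex numbers:
   (a * f)(x) = sum_g iota (a g) f(g^-1 x). *)
Definition lconv (K : zmodType) (iota : K -> R[i]) (a : {malg K[G]})
    (f : l2) : l2 :=
  \sum_(g <- msupp a) iota a@_g *: l2_shift g f.

Definition bounded_operator (T : l2 -> l2) : Prop :=
  linear T /\ exists M : R, forall f, l2norm (T f) <= M * l2norm f.

(* L(G): basic weak-operator neighbourhoods of T are given by finitely many
   pairs (u, v) of vectors and a tolerance e. *)
Definition group_vN_algebra : set (l2 -> l2) :=
  [set T | bounded_operator T /\
    forall (s : seq (l2 * l2)) (e : R), 0 < e ->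
      exists a : {malg R[i][G]}, forall u v, (u, v) \in s ->
        Normc.normc (l2dot (T u - lconv id a u) v) < e].

Definition vN_trace (T : l2 -> l2) : R[i] := l2dot (T l2_delta) l2_delta.

Definition orthogonal_projection (K : set l2) (P : l2 -> l2) : Prop :=
  forall f, K (P f) /\ forall k, K k -> l2dot (f - P f) k = 0.

(* No closedness assumption on K is needed: K is then the range of the
   bounded linear idempotent P, hence a closed subspace, and P is unique. *)
Definition has_vN_dim (K : set l2) (x : R) : Prop :=
  exists P, [/\ group_vN_algebra P, orthogonal_projection K P
              & vN_trace P = x%:C%C].

End L2Theory.

Definition group_ring_mul (K : pzRingType) (G : groupType)
    (a b : {malg K[G]}) : {malg K[G]} :=
  \sum_(g <- msupp a) \sum_(h <- msupp b) << a@_g * b@_h *g (g * h)%g >>.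

(* The cyclic group of order m is the additive group 'Z_m, which has order m
   only for m > 1. *)
Section Lamplighter.
Variables (d m : nat).

Definition lamplighter := wreath 'Z_m (free_group 'I_d).
HB.instance Definition _ := Group.on lamplighter.

Local Notation inF := (@wr_inr 'Z_m (free_group 'I_d)).
Local Notation inC := (@wr_inl 'Z_m (free_group 'I_d)).

Definition lampT : {malg rat[lamplighter]} :=
  \sum_(i < d) (<< inF (fg_gen i) >> + << inF (fg_gen i)^-1%g >>).

Definition lampE : {malg rat[lamplighter]} :=
  m%:R^-1 *: \sum_(h : 'Z_m) << inC h >>.

Definition lampETE : {malg rat[lamplighter]} :=
  group_ring_mul (group_ring_mul lampE lampT) lampE.

Definition lamp_ker (R : realType) : set (l2 R lamplighter) :=
  [set f | lconv (@ratr R[i]) lampETE f = 0].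

End Lamplighter.

Arguments lamp_ker : clear implicits.

(* Main.v *)
(* For z in F_d let x_z be the point mass of l2(Gamma) at z, and let R_z be the
   average of the right translations by z^-1 h z, h in C_m.  The R_z are commuting
   orthogonal projections, they commute with every left convolution, and the
   lamplighter operator T satisfies T x_z = sum_g R_gz R_z x_gz over the 2d letters
   g.  Hence on the range of a product of projections R_z (z open) and 1 - R_z
   (z closed) T acts like the adjacency operator of the open subgraph of the
   2d-regular tree, each site being open with probability p = 1/m.  As
   p(2d-1) < 1, the open cluster of the root is finite up to small probability.

   For a finite tree A with root r there is an explicit decomposition r = v + A w
   with A v = 0, computed from the leaves up, and v(r) = <P_ker r, r> is given by a
   recursion in which r carries kernel mass iff no child branch does.  Applied to
   x_1 this yields <P x_1, x_1> as an expected kernel mass at the root.  Let alpha be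
   the probability that a branch is open and carries kernel mass at its root, so
   alpha = p(1 - alpha)^(2d-1), i.e. alpha = 1 - 1/tau.  The kernel mass at a vertex
   is 1 minus a sum of edge weights, symmetric in the two branches across the edge;
   exchanging these independent branches replaces the sum of weights by quantities
   that only depend on alpha.

   The projection P onto ker T is the strong limit of (1 - T^2/c)^n.  For the
   irrationality, sigma = 1/tau is a root of x^n + mx - m, n = 2d-1; it is not an
   integer, hence irrational.  A rational dimension would make it quadratic with
   conjugate 2n/(n-1) - sigma > 1, but x^n + mx - m > 0 for x > 1. *)

From HB Require Import structures.
Require Import Defs.
From mathcomp Require Import all_boot all_order all_algebra fingroup finmap.
From mathcomp Require Import monalg.
From mathcomp Require Import all_classical all_reals all_analysis.
From mathcomp Require Import complex ring lra zify.

Set Implicit Arguments.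
Unset Strict Implicit.
Unset Printing Implicit Defensive.

Import Order.TTheory GRing.Theory Num.Theory.

Local Open Scope ring_scope.

(** * Square-summable functions on a group *)

Section RealSums.
Variables (R : realType) (T : groupType).
Implicit Types (u v f g : T -> R) (a : R).

Definition rsummable u : Prop := (\esum_(x in [set: T]) `|u x|%:E < +oo)%E.

Lemma rsummable_ge0E u : (forall x, 0 <= u x) ->
  rsummable u <-> (\esum_(x in [set: T]) (u x)%:E < +oo)%E.
Proof.
move=> u0; rewrite /rsummable (eq_esum (b := EFin \o u)) // => x _ /=.
by rewrite ger0_norm.
Qed.

Lemma esum_fin_num u : (forall x, 0 <= u x) -> rsummable u ->
  (\esum_(x in [set: T]) (u x)%:E)%E \is a fin_num.
Proof.
move=> u0 /(rsummable_ge0E u0) su.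
by rewrite ge0_fin_numE // esum_ge0 // => x _; rewrite lee_fin.
Qed.

Lemma le_rsummable u v : (forall x, `|u x| <= v x) -> rsummable v -> rsummable u.
Proof.
move=> uv; apply: le_lt_trans; apply: le_esum => x _.
by rewrite lee_fin (le_trans (uv x)) ?ler_norm.
Qed.

Lemma rsummableD u v : rsummable u -> rsummable v -> rsummable (fun x => u x + v x).
Proof.
move=> su sv; apply: le_lt_trans (lte_add_pinfty su sv).
rewrite -esumD => [|x _|x _]; rewrite ?lee_fin //.
by apply: le_esum => x _; rewrite -EFinD lee_fin ler_normD.
Qed.

Lemma rsummableN u : rsummable u -> rsummable (fun x => - u x).
Proof. by apply: le_lt_trans; apply: le_esum => x _; rewrite normrN. Qed.

(** Any splitting into nonnegative summable parts computes [rsum], not just the positive and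
    negative parts; hence additivity of [rsum] follows from that of nonnegative sums. *)
Lemma rsumBE f g : (forall x, 0 <= f x) -> (forall x, 0 <= g x) ->
  rsummable f -> rsummable g ->
  rsum (fun x => f x - g x) = fine (\esum_(x in [set: T]) (f x)%:E)
                            - fine (\esum_(x in [set: T]) (g x)%:E).
Proof.
move=> f0 g0 sf sg; rewrite /rsum.
have -> : EFin \o (fun x => f x - g x) = ((EFin \o f) \- (EFin \o g))%E.
  by apply/funext => x /=; rewrite EFinB.
rewrite esumB //=.
- by rewrite fineB //; exact: esum_fin_num.
- by move=> x _; rewrite lee_fin.
- by move=> x _; rewrite lee_fin.
Qed.

Lemma fine_esumD f g : (forall x, 0 <= f x) -> (forall x, 0 <= g x) ->
  rsummable f -> rsummable g ->
  fine (\esum_(x in [set: T]) (f x + g x)%:E) =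
  fine (\esum_(x in [set: T]) (f x)%:E) + fine (\esum_(x in [set: T]) (g x)%:E).
Proof.
move=> f0 g0 sf sg; rewrite -fineD ?esum_fin_num //.
by rewrite -esumD // => x _; rewrite lee_fin.
Qed.

Lemma rsum_ge0E f : (forall x, 0 <= f x) -> rsummable f ->
  rsum f = fine (\esum_(x in [set: T]) (f x)%:E).
Proof.
move=> f0 sf; have := @rsumBE f (fun=> 0) f0 (fun=> lexx _) sf.
rewrite [X in _ - fine X]esum1 // subr0.
have -> : (fun x => f x - 0) = f by apply/funext => x; rewrite subr0.
by apply; rewrite /rsummable esum1 ?ltry // => x _; rewrite normr0.
Qed.

Lemma posnegE u : u = (fun x => Num.max (u x) 0 - Num.max (- u x) 0).
Proof.
apply/funext => x; case: (leP (u x) 0) => u0.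
  by rewrite max_l ?oppr_ge0 // opprK add0r.
by rewrite max_r ?subr0 // oppr_le0 ltW.
Qed.

Lemma max0_ge0 (a : R) : 0 <= Num.max a 0.
Proof. by rewrite le_max lexx orbT. Qed.

Lemma rsummable_pos u : rsummable u -> rsummable (fun x => Num.max (u x) 0).
Proof.
move=> su; apply: (@le_rsummable _ (fun x => `|u x|)).
  by move=> x; rewrite ger0_norm ?max0_ge0 // ge_max ler_norm normr_ge0.
by apply: le_lt_trans su; apply: le_esum => x _; rewrite normr_id.
Qed.

Lemma rsummable_neg u : rsummable u -> rsummable (fun x => Num.max (- u x) 0).
Proof. by move/rsummableN/rsummable_pos. Qed.

Lemma rsumD u v : rsummable u -> rsummable v ->
  rsum (fun x => u x + v x) = rsum u + rsum v.
Proof.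
move=> su sv.
pose up x := Num.max (u x) 0; pose un x := Num.max (- u x) 0.
pose vp x := Num.max (v x) 0; pose vn x := Num.max (- v x) 0.
have -> : (fun x => u x + v x) = (fun x => (up x + vp x) - (un x + vn x)).
  apply/funext => x; rewrite {1}(posnegE u) {1}(posnegE v) -/(up x) -/(un x).
  by rewrite -/(vp x) -/(vn x); ring.
rewrite rsumBE; last 4 first.
- by move=> x; rewrite addr_ge0 ?max0_ge0.
- by move=> x; rewrite addr_ge0 ?max0_ge0.
- by apply: rsummableD; apply: rsummable_pos.
- by apply: rsummableD; apply: rsummable_neg.
rewrite !fine_esumD; try (by move=> x; exact: max0_ge0);
  try (exact: rsummable_pos); try (exact: rsummable_neg).
rewrite [in RHS](posnegE u) [in RHS](posnegE v) !rsumBE;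
  try (by move=> x; exact: max0_ge0);
  try (exact: rsummable_pos); try (exact: rsummable_neg).
rewrite -/up -/un -/vp -/vn; ring.
Qed.

Lemma rsumN u : rsummable u -> rsum (fun x => - u x) = - rsum u.
Proof.
move=> su; rewrite [in RHS](posnegE u).
have -> : (fun x => - u x) = (fun x => Num.max (- u x) 0 - Num.max (u x) 0).
  by apply/funext => x; rewrite {1}(posnegE u) opprB.
rewrite !rsumBE; first by rewrite opprB.
all: by [move=> x; exact: max0_ge0 | exact: rsummable_pos | exact: rsummable_neg].
Qed.

Lemma rsum_fset_le u (A : {fset T}) : (forall x, 0 <= u x) -> rsummable u ->
  \sum_(x <- A) u x <= rsum u.
Proof.
move=> u0 su; rewrite rsum_ge0E // -lee_fin fineK ?esum_fin_num //.
apply: ereal_sup_ubound; exists [set` A]%classic.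
  by split => //; exact: finite_fset.
rewrite fsbig_finite /=; last exact: finite_fset.
by rewrite set_fsetK sumEFin.
Qed.

(** Together with [rsum_fset_le] this lets infinite sums be estimated through finite ones. *)
Lemma rsum_le_fset u (c : R) : (forall x, 0 <= u x) ->
  (forall A : {fset T}, \sum_(x <- A) u x <= c) -> rsummable u /\ rsum u <= c.
Proof.
move=> u0 uc.
have le_c : (\esum_(x in [set: T]) (u x)%:E <= c%:E)%E.
  apply: ge_ereal_sup => _ [A [finA _] <-].
  rewrite fsbig_finite //= sumEFin lee_fin; exact: uc.
have su : rsummable u by apply/rsummable_ge0E => //; exact: le_lt_trans le_c (ltry _).
by split => //; rewrite rsum_ge0E // -lee_fin fineK ?esum_fin_num.
Qed.

Lemma rsum_ge0 u : (forall x, 0 <= u x) -> rsummable u -> 0 <= rsum u.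
Proof. by move=> u0 su; have := rsum_fset_le fset0 u0 su; rewrite big_seq_fset0. Qed.

Lemma rsummableZ a u : rsummable u -> rsummable (fun x => a * u x).
Proof.
move=> su; apply/(@le_rsummable _ (fun x => `|a| * `|u x|)).
  by move=> x; rewrite normrM.
have [||//] := @rsum_le_fset (fun x => `|a| * `|u x|) (`|a| * rsum (fun x => `|u x|)).
  by move=> x; rewrite mulr_ge0.
move=> A; rewrite -mulr_sumr ler_wpM2l //; apply: rsum_fset_le => //.
by apply: le_lt_trans su; apply: le_esum => x _; rewrite normr_id.
Qed.

Lemma rsumZ_ge0 a u : 0 <= a -> (forall x, 0 <= u x) -> rsummable u ->
  rsum (fun x => a * u x) = a * rsum u.
Proof.
have le_Z b w : 0 <= b -> (forall x, 0 <= w x) -> rsummable w ->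
    rsum (fun x => b * w x) <= b * rsum w.
  move=> b0 w0 sw; apply: (proj2 (@rsum_le_fset _ _ _ _)).
    by move=> x; rewrite mulr_ge0.
  by move=> A; rewrite -mulr_sumr ler_wpM2l //; exact: rsum_fset_le.
rewrite le_eqVlt => /predU1P[<-|a0] u0 su.
  apply/eqP; rewrite eq_le le_Z // mul0r rsum_ge0 //.
    by move=> x; rewrite mul0r.
  exact: rsummableZ.
(* The reverse inequality is [le_Z] for the factor [a^-1] and the function [a * u]. *)
apply/eqP; rewrite eq_le le_Z ?(ltW a0) //= -ler_pdivlMl //.
have := @le_Z a^-1 (fun x => a * u x) _ _ (rsummableZ a su).
have -> : (fun x => a^-1 * (a * u x)) = u.
  by apply/funext => x; rewrite mulKf // gt_eqF.
by apply; [rewrite invr_ge0 ltW | move=> x; rewrite mulr_ge0 // ltW].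
Qed.

Lemma rsumZ a u : rsummable u -> rsum (fun x => a * u x) = a * rsum u.
Proof.
have pos b w : 0 <= b -> rsummable w -> rsum (fun x => b * w x) = b * rsum w.
  move=> b0 sw; rewrite [in RHS](posnegE w).
  have -> : (fun x => b * w x) =
      (fun x => b * Num.max (w x) 0 - b * Num.max (- w x) 0).
    by apply/funext => x; rewrite {1}(posnegE w) mulrBr.
  have wp0 x : 0 <= Num.max (w x) 0 by exact: max0_ge0.
  have wn0 x : 0 <= Num.max (- w x) 0 by exact: max0_ge0.
  have swp := rsummable_pos sw; have swn := rsummable_neg sw.
  have sZp := rsummableZ b swp; have sZn := rsummableZ b swn.
  rewrite (rsumD sZp (rsummableN sZn)) (rsumN sZn) !rsumZ_ge0 //.
  by rewrite (rsumD swp (rsummableN swn)) (rsumN swn) mulrBr.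
move=> su; have [a0|/ltW a0] := leP 0 a; first exact: pos.
have -> : (fun x => a * u x) = (fun x => (- a) * (- u x)).
  by apply/funext => x; rewrite mulrNN.
by rewrite pos ?oppr_ge0 ?rsumN ?mulrNN //; exact: rsummableN.
Qed.

Lemma reindex_rsummable u (h k : T -> T) : cancel h k -> cancel k h ->
  rsummable u -> rsummable (fun x => u (h x)).
Proof.
move=> hK kH; rewrite /rsummable.
have bij : set_bij [set: T] [set: T] h.
  by rewrite setTT_bijective; exists k.
by rewrite (reindex_esum [set: T] [set: T] h (fun x => `|u x|%:E)).
Qed.

Lemma reindex_rsum u (h k : T -> T) : cancel h k -> cancel k h ->
  rsum (fun x => u (h x)) = rsum u.
Proof.
move=> hK kH.
have bij : set_bij [set: T] [set: T] h.
  by rewrite setTT_bijective; exists k.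
have reE (a : T -> \bar R) :
    (\esum_(j in [set: T]) a (h j) = \esum_(i in [set: T]) a i)%E.
  by symmetry; exact: reindex_esum.
rewrite /rsum -(reE (EFin \o u)^\+%E) -(reE (EFin \o u)^\-%E).
by congr (fine (_ - _)%E); apply: eq_esum => x _; rewrite ?funeposE ?funenegE.
Qed.

Lemma rsum_single u x0 : (forall x, x != x0 -> u x = 0) -> rsum u = u x0.
Proof.
have pos v : (forall x, 0 <= v x) -> (forall x, x != x0 -> v x = 0) ->
    rsummable v /\ rsum v = v x0.
  move=> v0 vx0.
  have [A|sv v_le] := @rsum_le_fset v (v x0) v0.
    case: (boolP (x0 \in A)) => xA.
      rewrite (big_fsetD1 x0) //= big_seq big1 ?addr0 // => x.
      by rewrite in_fsetD1 => /andP[/vx0].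
    rewrite big_seq big1 // => x xA'; apply: vx0.
    by apply: contraNneq xA => <-.
  split=> //; apply/eqP; rewrite eq_le v_le.
  by have := rsum_fset_le [fset x0]%fset v0 sv; rewrite big_seq_fset1.
move=> ux0; have wp0 x : 0 <= Num.max (u x) 0 by exact: max0_ge0.
have wn0 x : 0 <= Num.max (- u x) 0 by exact: max0_ge0.
have [|sp ep] := pos (fun x => Num.max (u x) 0) wp0.
  by move=> x /ux0 ->; rewrite maxxx.
have [|sn en] := pos (fun x => Num.max (- u x) 0) wn0.
  by move=> x /ux0 ->; rewrite oppr0 maxxx.
rewrite {1}(posnegE u) rsumD ?rsumN ?ep ?en //; last exact: rsummableN.
by rewrite [RHS](congr1 (fun f => f x0) (posnegE u)).
Qed.

End RealSums.

(** * Inner product and norm of square-summable functions *)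

Section Inner.
Variables (R : realType) (G : groupType).
Local Notation C := R[i].
Local Notation l2 := (l2 R G).
Local Notation Re := complex.Re.
Local Notation Im := complex.Im.
Implicit Types (f g h : l2) (a b : C) (r : R).

Lemma ReD a b : Re (a + b) = Re a + Re b. Proof. by case: a b => ? ? []. Qed.
Lemma ImD a b : Im (a + b) = Im a + Im b. Proof. by case: a b => ? ? []. Qed.
Lemma ReN a : Re (- a) = - Re a. Proof. by case: a. Qed.
Lemma ImN a : Im (- a) = - Im a. Proof. by case: a. Qed.
Lemma ReM a b : Re (a * b) = Re a * Re b - Im a * Im b.
Proof. by case: a b => ? ? []. Qed.
Lemma ImM a b : Im (a * b) = Re a * Im b + Im a * Re b.
Proof. by case: a b => ? ? []. Qed.
Lemma ReJ a : Re a^*%C = Re a. Proof. by case: a. Qed.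
Lemma ImJ a : Im a^*%C = - Im a. Proof. by case: a. Qed.

Lemma conjD a b : (a + b)^*%C = a^*%C + b^*%C.
Proof. by case: a b => ? ? [? ?]; congr Complex; rewrite /= opprD. Qed.
Lemma conjM a b : (a * b)^*%C = a^*%C * b^*%C.
Proof.
by case: a b => ? ? [? ?]; congr Complex; rewrite /= ?mulrNN // mulrN mulNr opprD.
Qed.
Lemma conjN a : (- a)^*%C = - a^*%C.
Proof. by case: a. Qed.

Definition sqabs a : R := Re a ^+ 2 + Im a ^+ 2.

Lemma sqabs_ge0 a : 0 <= sqabs a.
Proof. by rewrite addr_ge0 ?sqr_ge0. Qed.

Lemma sqabsE a : Normc.normc a ^+ 2 = sqabs a.
Proof. by case: a => x y; rewrite /= sqr_sqrtr ?addr_ge0 ?sqr_ge0. Qed.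

Lemma sqabs_eq0 a : (sqabs a == 0) = (a == 0).
Proof.
by case: a => x y; rewrite /sqabs eq_complex /= paddr_eq0 ?sqr_ge0 // !sqrf_eq0.
Qed.

Lemma l2P f g : (forall x, f x = g x) -> f = g.
Proof. by move=> fg; apply/val_inj/funext. Qed.

Lemma l2fun0 x : (0 : l2) x = 0. Proof. by []. Qed.
Lemma l2funD f g x : (f + g) x = f x + g x. Proof. by []. Qed.
Lemma l2funN f x : (- f) x = - f x. Proof. by []. Qed.
Lemma l2funZ a f x : (a *: f) x = a * f x. Proof. by []. Qed.
Lemma l2fun_sum I (s : seq I) (P : pred I) (F : I -> l2) x :
  (\sum_(i <- s | P i) F i) x = \sum_(i <- s | P i) F i x.
Proof. by elim/big_rec2: _ => // i y z _ <-; rewrite l2funD. Qed.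

Lemma sqsummableE (u : G -> C) :
  reflect (rsummable (fun x => sqabs (u x))) (u \in @sqsummable R G).
Proof.
have e0 x : (0 <= (Normc.normc (u x) ^+ 2)%:E)%E by rewrite lee_fin sqr_ge0.
have eqE : (\esum_(x in [set: G]) (Normc.normc (u x) ^+ 2)%:E =
            \esum_(x in [set: G]) (`|sqabs (u x)|)%:E)%E.
  by apply: eq_esum => x _; rewrite sqabsE ger0_norm // sqabs_ge0.
rewrite /rsummable -eqE; exact: asboolP.
Qed.

Lemma l2_summable f : rsummable (fun x => sqabs (f x)).
Proof. exact/sqsummableE/valP. Qed.

Definition nrm2 f : R := rsum (fun x => sqabs (f x)).

Lemma nrm2_ge0 f : 0 <= nrm2 f.
Proof. by apply: rsum_ge0 => [x|]; [exact: sqabs_ge0 | exact: l2_summable]. Qed.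

Lemma mul_bound (p q s t : R) : `|p * q + s * t| <= (p ^+ 2 + s ^+ 2) + (q ^+ 2 + t ^+ 2).
Proof.
have h (x y : R) : `|x * y| <= x ^+ 2 + y ^+ 2.
  rewrite normrM -(real_normK (num_real x)) -(real_normK (num_real y)).
  have := sqr_ge0 (`|x| - `|y|); have := normr_ge0 x; have := normr_ge0 y.
  by nra.
by have := h p q; have := h s t; have := ler_normD (p * q) (s * t); lra.
Qed.

Lemma dot_summable f g :
  rsummable (fun x => Re (f x * (g x)^*%C)) /\
  rsummable (fun x => Im (f x * (g x)^*%C)).
Proof.
split; apply: (le_rsummable _ (rsummableD (l2_summable f) (l2_summable g))).
  by move=> x; rewrite ReM ReJ ImJ mulrN opprK; exact: mul_bound.
move=> x; rewrite ImM ReJ ImJ mulrN -mulNr.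
rewrite /sqabs [X in _ <= X + _]addrC -[X in _ <= X + _ + _]sqrrN.
by rewrite addrC mulNr -mulrN addrC; have := mul_bound (Re (f x)) (- Im (g x)) (Im (f x)) (Re (g x)); rewrite sqrrN; lra.
Qed.

Lemma Re_dot f g : Re (l2dot f g) = rsum (fun x => Re (f x * (g x)^*%C)).
Proof. by []. Qed.
Lemma Im_dot f g : Im (l2dot f g) = rsum (fun x => Im (f x * (g x)^*%C)).
Proof. by []. Qed.

Lemma complexP a b : Re a = Re b -> Im a = Im b -> a = b.
Proof. by case: a b => ? ? [? ?] /= -> ->. Qed.

Lemma l2dotDl f g h : l2dot (f + g) h = l2dot f h + l2dot g h.
Proof.
have [sf sf'] := dot_summable f h; have [sg sg'] := dot_summable g h.
apply: complexP; rewrite ?ReD ?ImD ?Re_dot ?Im_dot -rsumD //; congr rsum;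
  by apply/funext => x; rewrite l2funD mulrDl ?ReD ?ImD.
Qed.

Lemma l2dotZl a f g : l2dot (a *: f) g = a * l2dot f g.
Proof.
have [sf sf'] := dot_summable f g.
apply: complexP; rewrite ?ReM ?ImM ?Re_dot ?Im_dot -!rsumZ //.
  rewrite -rsumN; last exact: rsummableZ.
  rewrite -rsumD; [|exact: rsummableZ|exact/rsummableN/rsummableZ].
  by congr rsum; apply/funext => x; rewrite l2funZ -mulrA ReM.
rewrite -rsumD; [|exact: rsummableZ|exact: rsummableZ].
by congr rsum; apply/funext => x; rewrite l2funZ -mulrA ImM.
Qed.

Lemma l2dotC f g : l2dot g f = (l2dot f g)^*%C.
Proof.
have [sf sf'] := dot_summable f g.
apply: complexP; rewrite ?ReJ ?ImJ ?Re_dot ?Im_dot; last rewrite -rsumN //;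
  congr rsum; apply/funext => x.
  by rewrite !ReM !ReJ !ImJ; ring.
by rewrite !ImM !ReJ !ImJ; ring.
Qed.

Lemma l2dotDr f g h : l2dot f (g + h) = l2dot f g + l2dot f h.
Proof. by rewrite l2dotC l2dotDl conjD -!l2dotC. Qed.

Lemma l2dotZr a f g : l2dot f (a *: g) = a^*%C * l2dot f g.
Proof. by rewrite l2dotC l2dotZl conjM -l2dotC. Qed.

Lemma l2dot0l f : l2dot 0 f = 0.
Proof. by rewrite -(scale0r (0 : l2)) l2dotZl mul0r. Qed.
Lemma l2dot0r f : l2dot f 0 = 0.
Proof. by rewrite l2dotC l2dot0l conjc0. Qed.
Lemma l2dotNl f g : l2dot (- f) g = - l2dot f g.
Proof. by rewrite -scaleN1r l2dotZl mulN1r. Qed.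
Lemma l2dotNr f g : l2dot f (- g) = - l2dot f g.
Proof. by rewrite l2dotC l2dotNl conjN -l2dotC. Qed.
Lemma l2dotBl f g h : l2dot (f - g) h = l2dot f h - l2dot g h.
Proof. by rewrite l2dotDl l2dotNl. Qed.
Lemma l2dotBr f g h : l2dot f (g - h) = l2dot f g - l2dot f h.
Proof. by rewrite l2dotDr l2dotNr. Qed.
Lemma l2dot_suml I (s : seq I) (P : pred I) (F : I -> l2) g :
  l2dot (\sum_(i <- s | P i) F i) g = \sum_(i <- s | P i) l2dot (F i) g.
Proof.
by elim/big_rec2: _ => [|i y z _ <-]; rewrite ?l2dot0l ?l2dotDl.
Qed.
Lemma l2dot_sumr I (s : seq I) (P : pred I) (F : I -> l2) g :
  l2dot g (\sum_(i <- s | P i) F i) = \sum_(i <- s | P i) l2dot g (F i).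
Proof.
by elim/big_rec2: _ => [|i y z _ <-]; rewrite ?l2dot0r ?l2dotDr.
Qed.

Lemma l2dotff f : l2dot f f = (nrm2 f)%:C%C.
Proof.
have reE : (fun x => Re (f x * (f x)^*%C)) = (fun x => sqabs (f x)).
  by apply/funext => x; rewrite ReM ReJ ImJ /sqabs; ring.
have imE : (fun x => Im (f x * (f x)^*%C)) = (fun=> 0).
  by apply/funext => x; rewrite ImM ReJ ImJ; ring.
apply: complexP; first by rewrite Re_dot reE.
by rewrite Im_dot imE (@rsum_single _ _ _ 1%g).
Qed.

Lemma l2normE f : l2norm f = Num.sqrt (nrm2 f).
Proof. by rewrite /l2norm l2dotff. Qed.

Lemma sqabs_le_nrm2 f x : sqabs (f x) <= nrm2 f.
Proof.
have := rsum_fset_le [fset x]%fset (fun y => sqabs_ge0 (f y)) (l2_summable f).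
by rewrite big_seq_fset1.
Qed.

Lemma nrm2_eq0 f : nrm2 f = 0 -> f = 0.
Proof.
move=> f0; apply: l2P => x; apply/eqP; rewrite l2fun0 -sqabs_eq0 eq_le sqabs_ge0.
by rewrite -f0 sqabs_le_nrm2.
Qed.

Lemma nrm2D f g : nrm2 (f + g) = nrm2 f + nrm2 g + 2 * Re (l2dot f g).
Proof.
have := l2dotff (f + g); rewrite l2dotDl !l2dotDr !l2dotff [l2dot g f]l2dotC.
move/(congr1 (@complex.Re R)); rewrite !ReD ReJ /= => <-; ring.
Qed.

Lemma nrm2Z a f : nrm2 (a *: f) = sqabs a * nrm2 f.
Proof.
have := l2dotff (a *: f); rewrite l2dotZl l2dotZr l2dotff => /(congr1 (@complex.Re R)) /= <-.
by rewrite !ReM !ImM !ReJ !ImJ /= /sqabs; ring.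
Qed.

Lemma nrm2N f : nrm2 (- f) = nrm2 f.
Proof. by rewrite -scaleN1r nrm2Z /sqabs ReN ImN /= !sqrrN expr1n expr0n addr0 mul1r. Qed.

Lemma cauchy_schwarz f g : sqabs (l2dot f g) <= nrm2 f * nrm2 g.
Proof.
have [g0|g0] := eqVneq (nrm2 g) 0.
  by rewrite (nrm2_eq0 g0) l2dot0r /sqabs /= !expr0n addr0 mulr_ge0 ?nrm2_ge0.
have gp : 0 < nrm2 g by rewrite lt_neqAle eq_sym g0 nrm2_ge0.
(* This [a] makes [f + a *: g] orthogonal to [g], which minimises its norm. *)
set w := l2dot f g; pose a : C := - (w * ((nrm2 g)^-1)%:C%C).
have := nrm2_ge0 (f + a *: g); rewrite nrm2D nrm2Z l2dotZr -/w.
have -> : Re (a^*%C * w) = - (sqabs w / nrm2 g).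
  by rewrite /a /sqabs !ReM ReJ ImJ ReN ImN !ReM !ImM /=; ring.
have -> : sqabs a = sqabs w / nrm2 g ^+ 2.
  rewrite /a /sqabs ReN ImN !ReM !ImM /=; field.
  exact: g0.
have -> : nrm2 f + sqabs w / nrm2 g ^+ 2 * nrm2 g + 2 * - (sqabs w / nrm2 g)
  = nrm2 f - sqabs w / nrm2 g by field.
by rewrite subr_ge0 ler_pdivrMr.
Qed.

Fact l2_point_subproof (y : G) : (fun x => (x == y)%:R) \in @sqsummable R G.
Proof.
apply/sqsummableE.
have [|//] := @rsum_le_fset R G (fun x => sqabs (x == y)%:R) 1 (fun x => sqabs_ge0 _).
have s0 : sqabs (0 : C) = 0 by rewrite /sqabs /= expr0n addr0.
move=> A; case: (boolP (y \in A)) => yA.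
  rewrite (big_fsetD1 y) //= eqxx big_seq big1.
    by rewrite /sqabs /= expr1n expr0n !addr0.
  by move=> x; rewrite in_fsetD1 => /andP[/negbTE -> _].
rewrite big_seq big1 // => x xA; have /negbTE -> // : x != y.
by apply: contraNneq yA => <-.
Qed.

Definition l2_point (y : G) : l2 := L2 (l2_point_subproof y).

Lemma l2_delta_point : l2_delta R G = l2_point 1%g.
Proof. exact: l2P. Qed.

Lemma l2dot_point f y : l2dot f (l2_point y) = f y.
Proof.
have z x : x != y -> f x * (l2_point y x)^*%C = 0.
  by move=> /negbTE xy; rewrite /= xy conjc0 mulr0.
have e : f y * (l2_point y y)^*%C = f y by rewrite /= eqxx conjc1 mulr1.
apply: complexP.
  by rewrite Re_dot (@rsum_single _ _ _ y) ?e // => x /z ->.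
by rewrite Im_dot (@rsum_single _ _ _ y) ?e // => x /z ->.
Qed.

End Inner.

Section LinearFunctions.
Variables (K : comNzRingType) (V : lmodType K) (T : V -> V).
Hypothesis T_linear : linear T.

Lemma lin0 : T 0 = 0.
Proof. by have := T_linear (-1) 0 0; rewrite scaler0 addr0 scaleN1r addNr. Qed.
Lemma linD u v : T (u + v) = T u + T v.
Proof. by have := T_linear 1 u v; rewrite !scale1r. Qed.
Lemma linZ a u : T (a *: u) = a *: T u.
Proof. by have := T_linear a u 0; rewrite lin0 !addr0. Qed.
Lemma linB u v : T (u - v) = T u - T v.
Proof. by rewrite linD -scaleN1r linZ scaleN1r. Qed.
Lemma lin_sum I (s : seq I) (P : pred I) (F : I -> V) :
  T (\sum_(i <- s | P i) F i) = \sum_(i <- s | P i) T (F i).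
Proof. exact: (big_morph T linD lin0). Qed.

End LinearFunctions.

(** * Completeness *)

Section Complete.
Import numFieldNormedType.Exports.
Variables (R : realType) (G : groupType).
Local Notation C := R[i].
Local Notation l2 := (l2 R G).
Local Notation Re := (@complex.Re R).
Local Notation Im := (@complex.Im R).

Lemma real_cauchy_lim (u : nat -> R) :
  (forall e : R, 0 < e -> exists N, forall n m, (N <= n)%N -> (N <= m)%N -> `|u n - u m| <= e) ->
  exists l, forall e : R, 0 < e -> exists N, forall n, (N <= n)%N -> `|u n - l| <= e.
Proof.
move=> cu.
have /cvg_ex [l /cvgrPdist_le ul] : cvgn u.
  apply/cauchy_cvgP/cauchy_ballP => e e0.
  have [N uN] := cu (e / 2) (divr_gt0 e0 (ltr0Sn _ 1)).
  exists ((u @` [set n | (N <= n)%N]), (u @` [set n | (N <= n)%N]))%classic.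
    by split; exists N => // n Nn; exists n.
  move=> [_ _] [[n /= Nn <-] [k /= Nk <-]]; rewrite /ball /=.
  by rewrite (@le_lt_trans _ _ (e / 2)) ?uN // ltr_pdivrMr ?ltr_pMr ?ltr1n.
exists l => e e0; have [N _ uN] := ul e e0.
by exists N => n Nn; rewrite distrC; exact: uN.
Qed.

Lemma sqabsD (a b : C) : sqabs (a + b) <= 2 * sqabs a + 2 * sqabs b.
Proof.
rewrite /sqabs ReD ImD; have := sqr_ge0 (Re a - Re b); have := sqr_ge0 (Im a - Im b).
nra.
Qed.

Lemma nrm2D_le (f g : l2) : nrm2 (f + g) <= 2 * nrm2 f + 2 * nrm2 g.
Proof.
have := nrm2_ge0 (f - g); rewrite nrm2D nrm2N l2dotNr ReN nrm2D; lra.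
Qed.

Lemma complex_cauchy_lim (u : nat -> C) :
  (forall e : R, 0 < e -> exists N, forall n m, (N <= n)%N -> (N <= m)%N -> sqabs (u n - u m) <= e) ->
  exists l, forall e : R, 0 < e -> exists N, forall n, (N <= n)%N -> sqabs (u n - l) <= e.
Proof.
move=> cu.
have bnd (x e : R) : 0 < e -> x ^+ 2 <= e ^+ 2 -> `|x| <= e.
  by move=> e0; rewrite -real_normK ?num_real // ler_pXn2r // ?nnegrE // ltW.
have [|p up] := @real_cauchy_lim (Re \o u).
  move=> e e0; have [N uN] := cu (e ^+ 2) (exprn_gt0 _ e0).
  exists N => n m Nn Nm; apply: bnd => //; apply: le_trans (uN n m Nn Nm).
  by rewrite /sqabs ReD ReN lerDl sqr_ge0.
have [|q uq] := @real_cauchy_lim (Im \o u).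
  move=> e e0; have [N uN] := cu (e ^+ 2) (exprn_gt0 _ e0).
  exists N => n m Nn Nm; apply: bnd => //; apply: le_trans (uN n m Nn Nm).
  by rewrite /sqabs ImD ImN lerDr sqr_ge0.
exists (p +i* q)%C => e e0.
pose d := Num.min 1 (e / 2).
have d0 : 0 < d by rewrite lt_min ltr01 divr_gt0.
have d2 : d ^+ 2 <= e / 2.
  apply: (@le_trans _ _ d); last by rewrite /d ge_min lexx orbT.
  by rewrite expr2 ger_pMr // /d ge_min lexx.
have [N1 H1] := up d d0; have [N2 H2] := uq d d0.
exists (maxn N1 N2) => n; rewrite geq_max => /andP[n1 n2].
rewrite /sqabs ReD ImD ReN ImN.
have sq (x : R) : `|x| <= d -> x ^+ 2 <= d ^+ 2.
  by move=> xd; rewrite -real_normK ?num_real // ler_pXn2r // nnegrE // ltW.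
by have := sq _ (H1 n n1); have := sq _ (H2 n n2) => /=; lra.
Qed.

(** The limit is taken pointwise; the norm bound is proved on every finite set and then passes to
    the whole sum, as in Fatou's lemma. *)
Lemma l2_complete (F : nat -> l2) :
  (forall e : R, 0 < e -> exists N, forall n m, (N <= n)%N -> (N <= m)%N -> nrm2 (F n - F m) <= e) ->
  exists g, forall e : R, 0 < e -> exists N, forall n, (N <= n)%N -> nrm2 (F n - g) <= e.
Proof.
move=> cF.
have /choice[g0 Fg] : forall x, exists l, forall e : R, 0 < e -> exists N, forall n,
    (N <= n)%N -> sqabs (F n x - l) <= e.
  move=> x; apply: complex_cauchy_lim => e e0; have [N FN] := cF e e0.
  by exists N => n m Nn Nm; apply: le_trans (FN n m Nn Nm); exact: (sqabs_le_nrm2 (F n - F m)).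
have Fsum (A : seq G) e : 0 < e -> exists N, forall n, (N <= n)%N ->
    \sum_(x <- A) sqabs (F n x - g0 x) <= e.
  elim: A e => [|x A IH] e e0; first by exists 0%N => n _; rewrite big_nil ltW.
  have e2 : 0 < e / 2 by rewrite divr_gt0.
  have [N1 H1] := Fg x _ e2; have [N2 H2] := IH _ e2.
  exists (maxn N1 N2) => n; rewrite geq_max => /andP[n1 n2].
  by rewrite big_cons; have := H1 n n1; have := H2 n n2; lra.
have bound e : 0 < e -> exists N, forall n, (N <= n)%N ->
    rsummable (fun x => sqabs (F n x - g0 x)) /\
    rsum (fun x => sqabs (F n x - g0 x)) <= e.
  move=> e0; have e4 : 0 < e / 4 by rewrite divr_gt0.
  have [N FN] := cF _ e4; exists N => n Nn; apply: rsum_le_fset => [x|A].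
    exact: sqabs_ge0.
  (* The intermediate index [k] depends on the finite set [A], but the resulting bound [e] does
     not. *)
  have [M FM] := Fsum A _ e4; pose k := maxn N M.
  have := FM k (leq_maxr _ _); have := FN n k Nn (leq_maxl _ _).
  have := rsum_fset_le A (fun x => sqabs_ge0 ((F n - F k) x)) (l2_summable (F n - F k)).
  rewrite -/(nrm2 _) => H1 H2 H3.
  apply: (@le_trans _ _ (2 * (\sum_(x <- A) sqabs ((F n - F k) x)) +
                         2 * \sum_(x <- A) sqabs (F k x - g0 x))); last by lra.
  rewrite !mulr_sumr -big_split /=; apply: ler_sum => x _.
  have -> : F n x - g0 x = (F n - F k) x + (F k x - g0 x).
    by rewrite l2funD l2funN addrA subrK.
  exact: sqabsD.
have [N gN] := bound 1 ltr01; have [sN _] := gN N (leqnn N).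
have g2 : g0 \in @sqsummable R G.
  have dN : (fun x => F N x - g0 x) \in @sqsummable R G by exact/sqsummableE.
  have -> : g0 = (F N - L2 dN : l2) :> (G -> C) by apply/funext => x; rewrite l2funD l2funN /= subKr.
  exact: valP.
exists (L2 g2) => e e0; have [M gM] := bound e e0.
by exists M => n Mn; have [] := gM n Mn.
Qed.

End Complete.

(** * Left translations and convolution operators *)

Section Convolution.
Variables (R : realType) (G : groupType).
Local Notation C := R[i].
Local Notation l2 := (l2 R G).
Implicit Types (f h : l2) (g : G).

Lemma l2_shiftE g f x : l2_shift g f x = f (g^-1 * x)%g. Proof. by []. Qed.

Lemma l2_shift_linear g : linear (@l2_shift R G g).
Proof. by move=> a f h; apply: l2P. Qed.
HB.instance Definition _ g :=
  GRing.isLinear.Build C l2 l2 *:%R (@l2_shift R G g) (l2_shift_linear g).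

Lemma l2_shiftM g1 g2 f : l2_shift (g1 * g2)%g f = l2_shift g1 (l2_shift g2 f).
Proof. by apply: l2P => x; rewrite !l2_shiftE invgM mulgA. Qed.

Lemma l2_shift1 f : l2_shift 1%g f = f.
Proof. by apply: l2P => x; rewrite l2_shiftE invg1 mul1g. Qed.

Lemma l2dot_shift g f h : l2dot (l2_shift g f) h = l2dot f (l2_shift g^-1 h).
Proof.
have mK := @mulKg G g; have mVK := @mulVKg G g.
apply: complexP; rewrite ?Re_dot ?Im_dot.
all: rewrite -[LHS](@reindex_rsum _ _ _ (fun x => g * x)%g (fun x => g^-1 * x)%g) //.
all: by congr rsum; apply/funext => x; rewrite !l2_shiftE invgK mulKg.
Qed.

Lemma nrm2_shift g f : nrm2 (l2_shift g f) = nrm2 f.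
Proof.
by apply: (@complexI R); rewrite -!l2dotff l2dot_shift -l2_shiftM mulVg l2_shift1.
Qed.

Section LConv.
Variables (K : comNzRingType) (iota : {rmorphism K -> C}).
Implicit Types a b : {malg K[G]}.

Lemma lconvEw (A : {fset G}) a f : (msupp a `<=` A)%fset ->
  lconv iota a f = \sum_(g <- A) iota a@_g *: l2_shift g f.
Proof.
move=> aA; rewrite /lconv (big_fset_incl _ aA) // => g _ ga.
by rewrite mcoeff_outdom // rmorph0 scale0r.
Qed.

Lemma lconvD a b f : lconv iota (a + b) f = lconv iota a f + lconv iota b f.
Proof.
have sab := msuppD_le a b.
rewrite (lconvEw _ sab) (lconvEw _ (fsubsetUl (msupp a) (msupp b))).
rewrite (lconvEw _ (fsubsetUr (msupp a) (msupp b))) -big_split.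
by apply: eq_bigr => g _; rewrite mcoeffD rmorphD scalerDl.
Qed.

Lemma lconv0 f : lconv iota 0 f = 0.
Proof. by rewrite /lconv msupp0 big_seq_fset0. Qed.

Lemma lconvZ k a f : lconv iota (k *: a) f = iota k *: lconv iota a f.
Proof.
rewrite (lconvEw _ (msuppZ_le k a)) /lconv scaler_sumr.
by apply: eq_bigr => g _; rewrite mcoeffZ rmorphM scalerA.
Qed.

Lemma lconvU k g f : lconv iota << k *g g >> f = iota k *: l2_shift g f.
Proof. by rewrite (lconvEw _ msuppU_le) big_seq_fset1 mcoeffUU. Qed.

Lemma lconv_sum I (s : seq I) (P : pred I) (F : I -> {malg K[G]}) f :
  lconv iota (\sum_(i <- s | P i) F i) f = \sum_(i <- s | P i) lconv iota (F i) f.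
Proof. by elim/big_rec2: _ => [|i y z _ <-]; rewrite ?lconv0 ?lconvD. Qed.

Lemma lconv_linear a : linear (lconv iota a).
Proof.
move=> k f h; rewrite /lconv scaler_sumr -big_split; apply: eq_bigr => g _.
by rewrite linearP scalerDr !scalerA mulrC.
Qed.

Lemma lconv_mul a b f :
  lconv iota (group_ring_mul a b) f = lconv iota a (lconv iota b f).
Proof.
rewrite /group_ring_mul lconv_sum [RHS]/lconv; apply: eq_bigr => g _.
rewrite lconv_sum /lconv linear_sum scaler_sumr; apply: eq_bigr => h _.
by rewrite -/(lconv _ _ _) lconvU rmorphM l2_shiftM linearZ scalerA.
Qed.

End LConv.

(** These are the operators allowed as approximants in [group_vN_algebra]; closure under sums and
    composition covers all polynomials in such an operator. *)
Definition is_conv (T : l2 -> l2) := exists a : {malg C[G]}, forall f, T f = lconv id a f.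

Let idC := (idfun : {rmorphism C -> C}).

Lemma is_conv_shift g : is_conv (@l2_shift R G g).
Proof. by exists << g >> => f; rewrite (lconvU idC) scale1r. Qed.
Lemma is_conv_id : is_conv id.
Proof. by exists << 1%g >> => f; rewrite (lconvU idC) scale1r l2_shift1. Qed.
Lemma is_convD T U : is_conv T -> is_conv U -> is_conv (fun f => T f + U f).
Proof. by move=> [a Ta] [b Ub]; exists (a + b) => f; rewrite (lconvD idC) Ta Ub. Qed.
Lemma is_convZ k T : is_conv T -> is_conv (fun f => k *: T f).
Proof. by move=> [a Ta]; exists (k *: a) => f; rewrite (lconvZ idC) Ta. Qed.
Lemma is_conv_comp T U : is_conv T -> is_conv U -> is_conv (fun f => T (U f)).
Proof.
by move=> [a Ta] [b Ub]; exists (group_ring_mul a b) => f; rewrite (lconv_mul idC) Ta Ub.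
Qed.
Lemma is_conv_sum I (s : seq I) (T : I -> l2 -> l2) :
  (forall i, is_conv (T i)) -> is_conv (fun f => \sum_(i <- s) T i f).
Proof.
move=> cT; elim: s => [|i s [a Ta]].
  by exists 0 => f; rewrite big_nil (lconv0 idC).
have [b Tb] := cT i; exists (b + a) => f.
by rewrite big_cons (lconvD idC) Ta Tb.
Qed.
Lemma is_conv_linear T : is_conv T -> linear T.
Proof. by move=> [a Ta] k f h; rewrite !Ta; exact: (lconv_linear idC). Qed.

(** Induction over the support with |a + b|^2 at most 2|a|^2 + 2|b|^2. A crude constant is enough,
    but it must be positive because it gets inverted in the iteration for the kernel projection. *)
Lemma is_conv_bounded T : is_conv T -> exists2 c, 0 < c & forall f, nrm2 (T f) <= c * nrm2 f.
Proof.
move=> [a Ta].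
suff [c c0 H] : exists2 c, 0 < c & forall f, nrm2 (lconv id a f) <= c * nrm2 f.
  by exists c => // f; rewrite Ta.
rewrite /lconv; elim: (enum_fset _) => [|g s [c c0 H]].
  exists 1 => // f; rewrite big_nil mul1r; have := nrm2_ge0 f; apply: le_trans.
  by rewrite -(scale0r (0 : l2)) nrm2Z /sqabs /= expr0n addr0 mul0r.
exists (2 * sqabs a@_g + 2 * c).
  by rewrite ltr_wpDl ?mulr_gt0 ?mulr_ge0 ?sqabs_ge0.
move=> f; rewrite big_cons; apply: le_trans (nrm2D_le _ _) _.
by rewrite nrm2Z nrm2_shift; have := H f; have := nrm2_ge0 f; nra.
Qed.

End Convolution.

(** * Projection onto the kernel of a self-adjoint convolution operator *)

Section OrthogonalProjection.
Variables (R : realType) (G : groupType).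
Local Notation C := R[i].
Local Notation l2 := (l2 R G).
Local Notation Re := (@complex.Re R).

Section Projection.
Variables (T P : l2 -> l2).
Hypothesis T_linear : linear T.
Hypothesis P_proj : orthogonal_projection [set f | T f = 0]%classic P.

Lemma proj_ker f : T (P f) = 0. Proof. by have [] := P_proj f. Qed.

Lemma proj_perp f k : T k = 0 -> l2dot (f - P f) k = 0.
Proof. by move=> Tk; have [_] := P_proj f; apply. Qed.

(** The difference [P f - u] lies in the kernel and is orthogonal to it. Linearity, idempotence and
    commutation of [P] are all derived from this. *)
Lemma proj_unique f u : T u = 0 -> (forall k, T k = 0 -> l2dot (f - u) k = 0) -> P f = u.
Proof.
move=> Tu fu; apply/subr0_eq/nrm2_eq0/(@complexI R); rewrite -l2dotff.
have Tk : T (P f - u) = 0 by rewrite (linB T_linear) proj_ker Tu subrr.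
rewrite -[X in l2dot X _](subrKA f) -opprB.
by rewrite l2dotDl l2dotNl proj_perp // fu // oppr0 addr0.
Qed.

Lemma proj_linear : linear P.
Proof.
move=> a f g; apply: proj_unique => [|k Tk].
  by rewrite T_linear !proj_ker scaler0 addr0.
rewrite opprD addrACA -scalerBr l2dotDl l2dotZl !proj_perp //.
by rewrite mulr0 addr0.
Qed.

Lemma proj_id u : T u = 0 -> P u = u.
Proof. by move=> Tu; apply: proj_unique => // k _; rewrite subrr l2dot0l. Qed.

Lemma proj_pythagoras f : nrm2 f = nrm2 (P f) + nrm2 (f - P f).
Proof.
have := nrm2D (P f) (f - P f); rewrite addrC subrK => ->.
by rewrite l2dotC proj_perp ?proj_ker // conjc0 /= mulr0 addr0.
Qed.

Lemma proj_norm f : l2norm (P f) <= l2norm f.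
Proof.
by rewrite !l2normE ler_wsqrtr // [leRHS]proj_pythagoras lerDl nrm2_ge0.
Qed.

Lemma proj_sa f g : l2dot (P f) g = l2dot f (P g).
Proof.
have -> : l2dot f (P g) = l2dot (P f) (P g).
  apply/eqP; rewrite -subr_eq0 -l2dotBl; apply/eqP/proj_perp/proj_ker.
rewrite l2dotC [RHS]l2dotC; congr (_^*)%C.
by apply/eqP; rewrite -subr_eq0 -l2dotBl; apply/eqP/proj_perp/proj_ker.
Qed.

Lemma proj_idem f : P (P f) = P f.
Proof. exact/proj_id/proj_ker. Qed.

Section SelfAdjoint.
Hypothesis T_sa : forall f g, l2dot (T f) g = l2dot f (T g).

Lemma proj_range f : P (T f) = 0.
Proof.
apply: proj_unique => [|k Tk]; first exact: lin0.
by rewrite subr0 T_sa Tk l2dot0r.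
Qed.

Section Commuting.
Variable Q : l2 -> l2.
Hypothesis Q_linear : linear Q.
Hypothesis Q_sa : forall f g, l2dot (Q f) g = l2dot f (Q g).
Hypothesis Q_idem : forall f, Q (Q f) = Q f.
Hypothesis Q_comm : forall f, T (Q f) = Q (T f).

(** A self-adjoint [Q] commuting with [T] preserves both the kernel and its orthogonal
    complement. *)
Lemma proj_comm f : P (Q f) = Q (P f).
Proof.
apply: proj_unique => [|k Tk]; first by rewrite Q_comm proj_ker (lin0 Q_linear).
by rewrite -(linB Q_linear) Q_sa proj_perp // Q_comm Tk (lin0 Q_linear).
Qed.

(** [P] and [Q] commute, so their product is a projection and the pairing is the squared norm of
    [P (Q f)]. This controls the trace on events where the exploration is cut off. *)
Lemma proj_sub_bounds f : exists2 r : R,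
  l2dot (P (Q f)) f = r%:C%C & 0 <= r <= nrm2 (Q f).
Proof.
exists (nrm2 (P (Q f))).
  by rewrite -l2dotff -proj_sa proj_idem !proj_comm -Q_sa Q_idem.
by rewrite nrm2_ge0 [leRHS]proj_pythagoras lerDl nrm2_ge0.
Qed.

End Commuting.
End SelfAdjoint.
End Projection.

Section KernelProjection.
Variable T : l2 -> l2.
Hypothesis T_conv : is_conv T.
Hypothesis T_sa : forall f g, l2dot (T f) g = l2dot f (T g).
Variable c : R.
Hypothesis c_gt0 : 0 < c.
Hypothesis T_bounded : forall f, nrm2 (T f) <= c * nrm2 f.

Let T_linear : linear T := is_conv_linear T_conv.

Let S f := f - (c^-1)%:C%C *: T (T f).

Let S_conv : is_conv S.
Proof.
have [a Ha] := is_convD (is_conv_id R G) (is_convZ (- (c^-1)%:C%C) (is_conv_comp T_conv T_conv)).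
by exists a => f; rewrite -Ha /S scaleNr.
Qed.

Let Sn n f := iter n S f.

Let Sn_conv n : is_conv (Sn n).
Proof.
by elim: n => [|n IH]; [exact: is_conv_id | exact: (is_conv_comp S_conv IH)].
Qed.

Let conj_real (r : R) : (r%:C^* = r%:C)%C.
Proof. by apply: complexP; rewrite ?ImJ ?ReJ //= oppr0. Qed.

Let S_sa f g : l2dot (S f) g = l2dot f (S g).
Proof.
by rewrite l2dotBl l2dotBr l2dotZl l2dotZr conj_real !T_sa.
Qed.

Let Sn_sa n f g : l2dot (Sn n f) g = l2dot f (Sn n g).
Proof.
elim: n f g => //= n IH f g.
by rewrite S_sa IH -/(Sn n _) /Sn -iterSr.
Qed.

Let SnT n f : Sn n (T f) = T (Sn n f).
Proof.
elim: n => // n IH; rewrite /Sn !iterS -!/(Sn _ _) IH /S.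
by rewrite (linB T_linear) (linZ T_linear).
Qed.

Let a n f : R := Re (l2dot (Sn n f) f).

Let aD n m f : Re (l2dot (Sn n f) (Sn m f)) = a (n + m) f.
Proof.
have e : Sn (n + m) f = Sn m (Sn n f) by rewrite /Sn -iterD addnC.
by rewrite /a e (Sn_sa m).
Qed.

(** The pairing equals |f|^2 - |T f|^2 / c, so positivity is exactly [T_bounded]. *)
Let S_ge0 f : 0 <= Re (l2dot (S f) f).
Proof.
rewrite l2dotBl l2dotZl T_sa !l2dotff ReD ReN ReM /= mul0r subr0 subr_ge0.
by rewrite ler_pdivrMl.
Qed.

Let a_ge0 n f : 0 <= a n f.
Proof.
rewrite -(odd_double_half n) -addnn addnA -aD.
case: (odd n); first exact: S_ge0.
rewrite add0n l2dotff; exact: nrm2_ge0.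
Qed.

Let a_dec n f : a n f - a n.+1 f = c^-1 * a n (T f).
Proof.
(* One factor [T] is moved to the other side, so a decrement of the moments of [f] is a moment of
   [T f] and hence nonnegative. *)
have e : Sn n f - Sn n.+1 f = (c^-1)%:C%C *: T (T (Sn n f)) by exact: subKr.
have -> : a n f - a n.+1 f = Re (l2dot (Sn n f - Sn n.+1 f) f).
  by rewrite l2dotBl ReD ReN.
by rewrite e l2dotZl ReM T_sa -SnT /= mul0r subr0.
Qed.

Let a_mono n m f : (n <= m)%N -> a m f <= a n f.
Proof.
move/subnK <-; elim: (m - n)%N => [|k IH]; first by rewrite add0n.
rewrite addSn; apply: le_trans IH; rewrite -subr_ge0 a_dec.
by rewrite mulr_ge0 ?a_ge0 // invr_ge0 ltW.
Qed.

(** The squared distance is a combination of moments that cancels in the limit, so convergence of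
    the moments makes the iterates Cauchy. *)
Let Sn_dist n m f :
  nrm2 (Sn n f - Sn m f) = a (n + n) f + a (m + m) f - 2 * a (n + m) f.
Proof.
rewrite nrm2D nrm2N l2dotNr ReN aD -!aD !l2dotff /=; ring.
Qed.

Let a_lim f : exists l, (forall n, l <= a n f) /\
  forall e, 0 < e -> exists N, forall n, (N <= n)%N -> a n f <= l + e.
Proof.
pose A := [set a n f | n in [set: nat]]%classic.
have hA : has_inf A.
  by split; [exists (a 0 f), 0%N | exists 0 => _ [n _ <-]].
exists (inf A); split=> [n|e e0]; first by apply: ge_inf; [case: hA | exists n].
have [_ [N _ <-] aN] := inf_adherent e0 hA.
by exists N => n Nn; apply: le_trans (a_mono f Nn) (ltW aN).
Qed.

Let Sn_cvg f : exists g, forall e, 0 < e -> exists N, forall n, (N <= n)%N ->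
  nrm2 (Sn n f - g) <= e.
Proof.
apply: l2_complete => e e0; have [l [la al]] := a_lim f.
have [N aN] := al (e / 2) (divr_gt0 e0 (ltr0Sn _ 1)).
exists N => n m Nn Nm; rewrite Sn_dist.
have := aN _ (leq_trans Nn (leq_addr n n)); have := aN _ (leq_trans Nm (leq_addr m m)).
by have := la (n + m)%N; lra.
Qed.

(* The powers of 1 - T^2/c converge strongly to the projection onto ker T:
   <S^n f, f> decreases, which makes S^n f a Cauchy sequence. *)
Theorem kernel_projection : exists P, group_vN_algebra P /\
  orthogonal_projection [set f | T f = 0]%classic P.
Proof.
have /choice[P PS] := Sn_cvg.
have Pproj : orthogonal_projection [set f | T f = 0]%classic P.
  move=> f; split=> [|k /= Tk].
    apply: nrm2_eq0; apply/eqP; rewrite eq_le nrm2_ge0 andbT.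
    apply/ler_addgt0Pr => e e0; rewrite add0r.
    have [l [la al]] := a_lim f.
    (* |T P f|^2 is at most 2c |P f - S^n f|^2 + 2 |T S^n f|^2, and the last norm is c times a
       decrement of moments; the tolerance e / (4c) makes each summand at most e / 2. *)
    have d0 : 0 < (c^-1 * e) / 4 by rewrite divr_gt0 // mulr_gt0 // invr_gt0.
    have [N1 H1] := al _ d0; have [N2 H2] := PS f _ d0.
    pose n := maxn N1 N2.
    have := H2 n (leq_maxr _ _).
    have := H1 _ (leq_trans (leq_maxl N1 N2) (leq_addr n n)).
    have := la (n + n).+1; have := a_dec (n + n) f.
    have := nrm2D_le (T (P f - Sn n f)) (T (Sn n f)).
    have := T_bounded (P f - Sn n f); rewrite -[in nrm2 (P f - _)]opprB nrm2N.
    have -> : nrm2 (T (Sn n f)) = a (n + n) (T f) by rewrite -aD l2dotff SnT.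
    rewrite -(linD T_linear) subrK.
    set x := nrm2 (T (P f)); set y := nrm2 (T _); set z := nrm2 (_ - _).
    set u := a _ f; set v := a _ f; set w := a _ _.
    move=> yz xy uv lv ul zd.
    have cc : c * c^-1 = 1 by rewrite divff // gt_eqF.
    have wE : w = c * (u - v) by rewrite uv mulrA cc mul1r.
    have := ler_wpM2l (ltW c_gt0) zd.
    have uvd : u - v <= c^-1 * e / 4 by lra.
    have := ler_wpM2l (ltW c_gt0) uvd; rewrite -wE !mulrA cc mul1r.
    lra.
  (* [S] fixes the kernel and is self-adjoint, so orthogonality holds for every iterate and survives
     the limit. *)
  have fS n : l2dot (f - Sn n f) k = 0.
    have Sk : Sn n k = k.
      by elim: n => //= n; rewrite /Sn => ->; rewrite /S Tk (lin0 T_linear) scaler0 subr0.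
    by rewrite l2dotBl Sn_sa Sk subrr.
  apply/eqP; rewrite -sqabs_eq0 eq_le sqabs_ge0 andbT.
  apply/ler_addgt0Pr => e e0; rewrite add0r.
  have k0 := nrm2_ge0 k.
  have d0 : 0 < e / (1 + nrm2 k) by rewrite divr_gt0 // ltr_pwDl.
  have [N H] := PS f _ d0.
  have -> : f - P f = (f - Sn N f) + (Sn N f - P f) by rewrite addrA subrK.
  rewrite l2dotDl fS add0r; apply: le_trans (cauchy_schwarz _ _) _.
  apply: (@le_trans _ _ (e / (1 + nrm2 k) * (1 + nrm2 k))).
    apply: ler_pM; rewrite ?nrm2_ge0 //; first exact: H.
    by rewrite lerDr.
  by rewrite divfK // gt_eqF // ltr_pwDl.
exists P; split=> //; split.
  split; first exact: (proj_linear T_linear Pproj).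
  by exists 1 => f; rewrite mul1r; exact: (proj_norm Pproj).
move=> s e e0.
suff [N HN] : exists N, forall n, (N <= n)%N -> forall u v, (u, v) \in s ->
    Normc.normc (l2dot (P u - Sn n u) v) < e.
  have [b Hb] := Sn_conv N; exists b => u v uv; rewrite -Hb; exact: HN.
elim: s => [|[u0 v0] s [N HN]]; first by exists 0%N.
have k0 : 0 < 1 + nrm2 v0 by rewrite ltr_pwDl // nrm2_ge0.
(* Cauchy-Schwarz is applied to squares: the half makes the final inequality strict, and 1 + |v|^2
   avoids dividing by zero. *)
have d0 : 0 < (e ^+ 2 / 2) / (1 + nrm2 v0) by rewrite !divr_gt0 // exprn_gt0.
have [M HM] := PS u0 _ d0.
exists (maxn N M) => n; rewrite geq_max => /andP[Nn Mn] u v.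
rewrite in_cons => /predU1P[[-> ->]|]; last exact: HN.
rewrite -(@ltr_pXn2r _ 2) ?nnegrE ?(ltW e0) //; last first.
  by case: (l2dot _ _) => *; exact: sqrtr_ge0.
rewrite sqabsE; apply: le_lt_trans (cauchy_schwarz _ _) _.
apply: (@le_lt_trans _ _ (e ^+ 2 / 2 / (1 + nrm2 v0) * (1 + nrm2 v0))).
  apply: ler_pM; rewrite ?nrm2_ge0 //; first by rewrite -opprB nrm2N; exact: HM.
  by rewrite lerDr.
rewrite divfK ?gt_eqF // ltr_pdivrMr // ltr_pMr ?exprn_gt0 //.
by rewrite ltr1n.
Qed.

End KernelProjection.
End OrthogonalProjection.

(** * Random finite trees *)

Section Expectation.
Variables (R : realType) (T : eqType).
Implicit Types (D : seq (R * T)) (F : T -> R).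

(** A law is a finite list of weighted values, possibly with repetitions, so that independent draws
    are products of lists. *)
Definition expect (U : Type) (D : seq (R * U)) (F : U -> R) : R :=
  \sum_(x <- D) x.1 * F x.2.

Fixpoint iid D k : seq (R * seq T) :=
  if k is k'.+1 then [seq (x.1 * y.1, x.2 :: y.2) | x <- D, y <- iid D k']
  else [:: (1, [::])].

Lemma expect_iid0 D (F : seq T -> R) : expect (iid D 0) F = F [::].
Proof. by rewrite /expect big_seq1 mul1r. Qed.

Lemma expect_iidS D k (F : seq T -> R) : expect (iid D k.+1) F =
  expect D (fun x => expect (iid D k) (fun xs => F (x :: xs))).
Proof.
rewrite /expect /= big_allpairs_dep; apply: eq_bigr => x _.
by rewrite mulr_sumr; apply: eq_bigr => y _; rewrite mulrA.
Qed.

Lemma expect_ext (U : Type) (D : seq (R * U)) (F1 F2 : U -> R) : F1 =1 F2 -> expect D F1 = expect D F2.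
Proof. by move=> e; apply: eq_bigr => x _; rewrite e. Qed.

Lemma expectD (U : Type) (D : seq (R * U)) (F1 F2 : U -> R) :
  expect D (fun x => F1 x + F2 x) = expect D F1 + expect D F2.
Proof. by rewrite -big_split; apply: eq_bigr => x _; rewrite mulrDr. Qed.

Lemma expectZ (U : Type) (D : seq (R * U)) a (F : U -> R) :
  expect D (fun x => a * F x) = a * expect D F.
Proof. by rewrite mulr_sumr; apply: eq_bigr => x _; rewrite mulrCA. Qed.

Lemma expectB (U : Type) (D : seq (R * U)) (F1 F2 : U -> R) :
  expect D (fun x => F1 x - F2 x) = expect D F1 - expect D F2.
Proof.
by rewrite -mulN1r -expectZ -expectD; apply: expect_ext => x; rewrite mulN1r.
Qed.

Lemma expect_swap (U V : Type) (D : seq (R * U)) (D' : seq (R * V)) (F : U -> V -> R) :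
  expect D (fun x => expect D' (F x)) = expect D' (fun y => expect D (F^~ y)).
Proof.
rewrite /expect; under eq_bigr do rewrite mulr_sumr; rewrite exchange_big.
by apply: eq_bigr => x _; rewrite mulr_sumr; apply: eq_bigr => y _; rewrite mulrCA.
Qed.

Lemma expect_prod D k (f : T -> R) :
  expect (iid D k) (fun xs => \prod_(x <- xs) f x) = expect D f ^+ k.
Proof.
elim: k => [|k IH]; first by rewrite expect_iid0 big_nil.
rewrite expect_iidS exprS mulrC -IH -expectZ; apply: expect_ext => x.
rewrite mulrC -expectZ; apply: expect_ext => xs; by rewrite big_cons.
Qed.

Lemma prod_all (P : pred T) (xs : seq T) : \prod_(x <- xs) (P x)%:R = (all P xs)%:R :> R.
Proof.
elim: xs => [|x xs IH]; first by rewrite big_nil.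
by rewrite big_cons IH /=; case: (P x); rewrite ?mul1r ?mul0r.
Qed.

Lemma expect_all D k (P : pred T) :
  expect (iid D k) (fun xs => (all P xs)%:R) = expect D (fun x => (P x)%:R) ^+ k.
Proof. by rewrite -expect_prod; apply: expect_ext => xs; rewrite prod_all. Qed.

(* Sum of [F x l] over the ways of splitting [xs] into one entry [x] and the list
   [l] of the others. *)
Fixpoint remsum (F : T -> seq T -> R) (xs : seq T) : R :=
  if xs is x :: xs' then F x xs' + remsum (fun y ys => F y (x :: ys)) xs' else 0.

Lemma remsum_perm (F : T -> seq T -> R) xs (f : T -> R) :
  (forall y ys, perm_eq (y :: ys) xs -> F y ys = f y) -> remsum F xs = \sum_(x <- xs) f x.
Proof.
elim: xs F => [|x xs IH] F Ff; first by rewrite big_nil.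
rewrite big_cons /= Ff //; congr (_ + _); apply: IH => y ys yxs.
apply: Ff; rewrite -(perm_cons x) in yxs; apply: perm_trans yxs.
by rewrite -[y :: x :: ys]/([:: y] ++ [:: x] ++ ys) perm_catCA.
Qed.

Lemma remsumD (F1 F2 : T -> seq T -> R) xs :
  remsum (fun x l => F1 x l + F2 x l) xs = remsum F1 xs + remsum F2 xs.
Proof.
elim: xs F1 F2 => [|x xs IH] F1 F2 /=; first by rewrite addr0.
by rewrite (IH (fun y ys => F1 y (x :: ys))) addrACA.
Qed.

(** Independent draws are exchangeable: each of the k + 1 ways to single out an entry has the same
    expectation. The induction swaps the first draw with the one singled out. *)
Lemma expect_remsum D k (F : T -> seq T -> R) :
  expect (iid D k.+1) (remsum F) = k.+1%:R * expect D (fun x => expect (iid D k) (F x)).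
Proof.
elim: k F => [|k IH] F.
  rewrite mul1r expect_iidS; apply: expect_ext => x.
  by rewrite !expect_iid0 /= addr0.
rewrite expect_iidS /= [X in X = _](_ : _ = expect D (fun x => expect (iid D k.+1) (F x)) +
    expect D (fun x => expect (iid D k.+1) (remsum (fun y ys => F y (x :: ys))))); last first.
  by rewrite -expectD; apply: expect_ext => x; rewrite -expectD.
have -> : expect D (fun x => expect (iid D k.+1) (remsum (fun y ys => F y (x :: ys)))) =
    k.+1%:R * expect D (fun x => expect (iid D k.+1) (F x)).
  transitivity (k.+1%:R * expect D (fun x => expect D (fun y =>
    expect (iid D k) (fun ys => F y (x :: ys))))).
    by rewrite -expectZ; apply: expect_ext => x; rewrite IH.
  rewrite expect_swap; congr (_ * _); apply: expect_ext => x.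
  by rewrite expect_iidS.
by rewrite -[k.+2]addn1 natrD addrC mulrDl mul1r.
Qed.

Definition nonneg (U : Type) (D : seq (R * U)) := all (fun x => 0 <= x.1) D.

Lemma nonneg_iid D k : nonneg D -> nonneg (iid D k).
Proof.
move=> D0; elim: k => [|k IH]; first by rewrite /nonneg /= ler01.
apply/allP => _ /allpairsP[[x y] /= [xD yD ->]] /=.
by rewrite mulr_ge0 ?(allP D0 x) ?(allP IH y).
Qed.

Lemma ler_expect_in (P : pred T) D F1 F2 : nonneg D -> all (fun x => P x.2) D ->
  (forall x, P x -> F1 x <= F2 x) -> expect D F1 <= expect D F2.
Proof.
move=> D0 DP F12; rewrite /expect big_seq [leRHS]big_seq; apply: ler_sum => x xD.
by rewrite ler_wpM2l ?(allP D0 x) // F12 // (allP DP).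
Qed.

Lemma expect_ge0 (P : pred T) D F : nonneg D -> all (fun x => P x.2) D ->
  (forall x, P x -> 0 <= F x) -> 0 <= expect D F.
Proof.
move=> D0 DP F0; have := ler_expect_in D0 DP F0; rewrite {1}/expect big1 // => x _.
by rewrite mulr0.
Qed.

Lemma all_iid (P : pred T) D k : all (fun x => P x.2) D ->
  all (fun x => all P x.2) (iid D k).
Proof.
move=> DP; elim: k => // k IH.
apply/allP => _ /allpairsP[[x y] /= [xD yD ->]] /=.
by rewrite (allP DP x) ?(allP IH y).
Qed.

End Expectation.

Lemma expect_eq_in (R : realType) (U : eqType) (P : pred U) (D : seq (R * U)) (F1 F2 : U -> R) :
  all (fun x => P x.2) D -> (forall x, P x -> F1 x = F2 x) -> expect D F1 = expect D F2.
Proof.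
move=> DP F12; rewrite /expect big_seq [RHS]big_seq; apply: eq_bigr => x xD.
by rewrite F12 // (allP DP).
Qed.

(* A message describes a rooted finite tree: [Some (true, h)] if some kernel
   vector of its adjacency operator is nonzero at the root r, with
   h = <P_ker r, r>; [Some (false, s)] if r = A g, with s = |g|^2 for the
   shortest such g (s = 0 encodes an absent vertex); [None] if the exploration
   of the tree was cut off. *)
Section Messages.
Variable R : realType.

Definition msg : Type := option (bool * R).
HB.instance Definition _ := Equality.on msg.
Implicit Types (m : msg) (ms : seq msg).

Definition is_ker m := if m is Some (true, _) then true else false.
Definition is_ran m := if m is Some (false, _) then true else false.
Definition is_fin m := m != None.
Definition kval m : R := if m is Some (true, h) then h else 0.
Definition rval m : R := if m is Some (false, s) then s else 0.
Definition valid m := if m is Some (b, x) then if b then 0 < x else 0 <= x else true.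

(** If every child root r_i is A g_i, then r - sum g_i is a multiple of P_ker r with value 1 at r
    and squared norm 1 + sum s_i, whence h = 1 / (1 + sum s_i). Otherwise the kernel projections u_i
    of the child roots satisfy A (sum u_i) = (sum h_i) r and |sum u_i|^2 = sum h_i, whence s = 1 /
    sum h_i. *)
Definition join ms : msg :=
  if all is_fin ms then
    if all is_ran ms then Some (true, (1 + \sum_(m <- ms) rval m)^-1)
    else Some (false, (\sum_(m <- ms) kval m)^-1)
  else None.

(* Weight of the edge joining two rooted trees with messages m1 and m2, when the
   first root carries kernel mass and the second does not.  Summed over the
   neighbours of a vertex these weights give 1 minus its kernel mass if no
   neighbouring branch carries kernel mass ([root_valE]), and 1 if at least two
   do ([remsum_edge]). *)
Definition edge m1 m2 : R :=
  if is_ker m1 && is_ran m2 then kval m1 * rval m2 / (1 + kval m1 * rval m2) else 0.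

Definition root_val ms : R := if all is_ran ms then (1 + \sum_(m <- ms) rval m)^-1 else 0.

Lemma kval_ge0 m : valid m -> 0 <= kval m.
Proof. by case: m => [[[] x]|] //= /ltW. Qed.
Lemma rval_ge0 m : valid m -> 0 <= rval m.
Proof. by case: m => [[[] x]|] //=. Qed.
Lemma sum_rval_ge0 ms : all valid ms -> 0 <= \sum_(m <- ms) rval m.
Proof. by move=> v; rewrite big_seq sumr_ge0 // => m mm; rewrite rval_ge0 // (allP v). Qed.
Lemma sum_kval_ge0 ms : all valid ms -> 0 <= \sum_(m <- ms) kval m.
Proof. by move=> v; rewrite big_seq sumr_ge0 // => m mm; rewrite kval_ge0 // (allP v). Qed.

Lemma sum_kval_gt0 ms : all valid ms -> has is_ker ms -> 0 < \sum_(m <- ms) kval m.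
Proof.
move=> + /hasP[m mm km]; rewrite (perm_all _ (perm_to_rem mm)) => /andP[vm vms].
rewrite (perm_big _ (perm_to_rem mm)) big_cons ltr_pwDl ?sum_kval_ge0 //.
by case: m km vm {mm vms} => [[[] x]|].
Qed.

Lemma ker_or_ran ms : all is_fin ms -> ~~ all is_ran ms -> has is_ker ms.
Proof.
elim: ms => //= m ms IH /andP[fm fms]; rewrite negb_and.
by case: m fm => [[[] x]|] //= _; apply: IH.
Qed.

Lemma all_ran_fin ms : all is_ran ms -> all is_fin ms.
Proof. by apply: sub_all => -[[[] x]|]. Qed.

Lemma valid_join ms : all valid ms -> valid (join ms).
Proof.
move=> v; rewrite /join; case: ifP => // fin; case: ifP => ran /=.
  by rewrite invr_gt0 ltr_pwDl // sum_rval_ge0.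
by rewrite invr_ge0 sum_kval_ge0.
Qed.

Lemma edge_bounds m1 m2 : valid m1 -> valid m2 -> 0 <= edge m1 m2 <= 1.
Proof.
move=> v1 v2; rewrite /edge; case: ifP => _; last by rewrite lexx ler01.
have h : 0 <= kval m1 * rval m2 by rewrite mulr_ge0 ?kval_ge0 ?rval_ge0.
by rewrite divr_ge0 ?addr_ge0 //= ler_pdivrMr ?ltr_pwDl // mul1r lerDr.
Qed.

Lemma edge_None m : (edge m None = 0) * (edge None m = 0).
Proof. by rewrite /edge /= andbF. Qed.

Lemma is_ker_join ms : is_ker (join ms) = all is_ran ms.
Proof.
rewrite /join; case: ifP => [_|fin]; first by case: ifP.
by apply/esym/negbTE; apply: contraFN fin; exact: all_ran_fin.
Qed.

Lemma is_fin_join ms : is_fin (join ms) = all is_fin ms.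
Proof. by rewrite /join; case: ifP => // _; case: ifP. Qed.

(** With S the sum of the values s, the mass 1 / (1 + S) is 1 minus the sum of s / (1 + S). Leaving
    out one branch gives h = 1 / (1 + S - s), and then h s / (1 + h s) = s / (1 + S). *)
Lemma root_valE ms : all valid ms ->
  root_val ms = (all is_ran ms)%:R - remsum (fun m l => edge (join l) m) ms.
Proof.
move=> v; rewrite /root_val; case: ifP => [ran|nran]; last first.
  rewrite (@remsum_perm _ _ _ _ (fun=> 0)) ?big1 ?subrr // => m l ml.
  rewrite /edge is_ker_join; case: ifP => // /andP[rl rm].
  by rewrite -(perm_all is_ran ml) /= rl rm in nran.
set S := \sum_(m <- ms) rval m.
have S1 : 1 + S != 0 by rewrite gt_eqF // ltr_pwDl // sum_rval_ge0.
rewrite (@remsum_perm _ _ _ _ (fun m => rval m / (1 + S))).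
  by rewrite -mulr_suml -/S (_ : true%:R = 1) //; field.
move=> m l ml; have := ran; rewrite -(perm_all is_ran ml) /= => /andP[rm rl].
have SE : S = rval m + \sum_(m <- l) rval m by rewrite /S -(perm_big _ ml) big_cons.
have := v; rewrite -(perm_all valid ml) /= => /andP[vm vl].
have := sum_rval_ge0 vl; have := rval_ge0 vm; have := S1; rewrite SE.
rewrite /edge is_ker_join rl rm /join (all_ran_fin rl) rl /=.
move: (rval m) (\sum_(i <- l) _) => x y xy x0 y0.
have y1 : 1 + y != 0 by rewrite gt_eqF // ltr_pwDl.
have e : 1 + (x + y) = 1 + y + x by ring.
by rewrite e in xy *; field; rewrite xy y1.
Qed.

(** With H the sum of the values h, leaving out one kernel branch gives s = 1 / (H - h), so its edge
    weight is h / H and the weights add up to 1. The exception is a single kernel branch: the rest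
    then carries kernel mass too, the weight is 0, and the last term makes up for it. *)
Lemma remsum_edge ms : all valid ms ->
  remsum (fun m l => edge m (join l)) ms =
  (all is_fin ms)%:R - (all is_ran ms)%:R - remsum (fun m l => (is_ker m && all is_ran l)%:R) ms.
Proof.
move=> v; apply/eqP; rewrite -subr_eq opprK; apply/eqP; rewrite -remsumD.
have [fin|nfin] := boolP (all is_fin ms); last first.
  have nran : all is_ran ms = false by apply: contraNF nfin; exact: all_ran_fin.
  rewrite nran (@remsum_perm _ _ _ _ (fun=> 0)) ?big1 ?subrr // => m l ml.
  rewrite -(perm_all _ ml) /= negb_and in nfin.
  have [/all_ran_fin fl|_] := boolP (all is_ran l).
    by case: m {ml} nfin => [[b x]|] /=; rewrite ?fl // /edge /= add0r.
  rewrite andbF addr0 /edge; case: ifP => // /andP[km].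
  by case: m km nfin {ml} => [[b x]|] //= _; rewrite /join => /negbTE ->.
have [ran|nran] := boolP (all is_ran ms).
  rewrite (@remsum_perm _ _ _ _ (fun=> 0)) ?big1 ?subrr // => m l ml.
  rewrite -(perm_all is_ran ml) /= in ran; rewrite /edge.
  by case: m ran {ml} => [[[] x]|] //=; rewrite addr0.
have H0 := sum_kval_gt0 v (ker_or_ran fin nran).
set H := \sum_(m <- ms) kval m in H0 *.
rewrite (@remsum_perm _ _ _ _ (fun m => kval m / H)).
  by rewrite -mulr_suml -/H divff ?gt_eqF // subr0.
move=> m l ml; have HE : H = kval m + \sum_(m <- l) kval m.
  by rewrite /H -(perm_big _ ml) big_cons.
have := v; rewrite -(perm_all valid ml) /= => /andP[vm vl].
have := fin; rewrite -(perm_all is_fin ml) /= => /andP[fm fl].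
have [km|nkm] := boolP (is_ker m); last first.
  rewrite /edge (negbTE nkm) /= addr0.
  by case: m nkm fm {ml HE vm} => [[[] x]|] //= _ _; rewrite mul0r.
have m0 : 0 < kval m by case: m km vm {ml HE fm} => [[[] x]|].
rewrite /edge km /join fl /=; have [rl|rl] := boolP (all is_ran l); rewrite /= ?rl /=.
  rewrite add0r HE [\sum_(i <- l) _]big_seq big1 ?addr0 ?divff ?gt_eqF // => i il.
  by have := allP rl i il; case: i {il} => [[[] x]|].
have l0 : 0 < \sum_(i <- l) kval i by exact/(sum_kval_gt0 vl)/(ker_or_ran fl).
have lh : 0 < kval m + \sum_(i <- l) kval i by rewrite addr_gt0.
rewrite addr0 HE; field.
by rewrite !gt_eqF // addrC.
Qed.

End Messages.

Arguments is_ker {R} m.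
Arguments is_ran {R} m.
Arguments is_fin {R} m.
Arguments valid {R} m.
Arguments edge {R} m1 m2.
Arguments root_val {R} ms.

(** * Law of the messages and mean kernel mass at the root *)

Section Law.
Variables (R : realType) (p : R) (k : nat).
Hypotheses (p_gt0 : 0 < p) (k_gt0 : (0 < k)%N) (pk_lt1 : p * k%:R < 1).
Local Notation msg := (msg R).
Local Notation K := k.+1.

(* Law of the message of a branch, an absent root having probability 1 - p, when
   the exploration is cut off at depth n. *)
Fixpoint law n : seq (R * msg) :=
  if n is n'.+1 then
    (1 - p, Some (false, 0)) :: [seq (p * x.1, join x.2) | x <- iid (law n') k]
  else [:: (1, None)].

Lemma expect_law0 F : expect (law 0) F = F None.
Proof. by rewrite /expect big_seq1 mul1r. Qed.

Lemma expect_lawS n F : expect (law n.+1) F =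
  (1 - p) * F (Some (false, 0)) + p * expect (iid (law n) k) (fun ms => F (join ms)).
Proof.
rewrite /expect big_cons big_map /= mulr_sumr; congr (_ + _).
by apply: eq_bigr => x _; rewrite mulrA.
Qed.

Lemma p_lt1 : p < 1.
Proof. by apply: le_lt_trans pk_lt1; rewrite ler_pMr // ler1n. Qed.

Lemma nonneg_law n : nonneg (law n).
Proof.
elim: n => [|n IH]; first by rewrite /nonneg /= ler01.
rewrite /nonneg /= subr_ge0 (ltW p_lt1) /=; apply/allP => _ /mapP[x xD ->] /=.
by rewrite mulr_ge0 ?(ltW p_gt0) // (allP (nonneg_iid k IH)).
Qed.

Lemma valid_law n : all (fun x => valid x.2) (law n).
Proof.
elim: n => [|n IH] //; rewrite /= lexx /=; apply/allP => _ /mapP[x xD ->] /=.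
by apply/valid_join/(allP (all_iid k IH)).
Qed.

Lemma expect_iid1 n j : expect (law n) (fun=> 1) = 1 -> expect (iid (law n) j) (fun=> 1) = 1.
Proof.
move=> e; transitivity (expect (iid (law n) j) (fun xs => (all predT xs)%:R)).
  by apply: expect_ext => xs; rewrite all_predT.
by rewrite expect_all e expr1n.
Qed.

Lemma expect_law1 n : expect (law n) (fun=> 1) = 1.
Proof.
elim: n => [|n IH]; first by rewrite expect_law0.
by rewrite expect_lawS expect_iid1 // !mulr1 subrK.
Qed.

Definition p_bad n : R := expect (law n) (fun m => (~~ is_fin m)%:R).
Definition p_ker n : R := expect (law n) (fun m => (is_ker m)%:R).
Definition p_ran n : R := expect (law n) (fun m => (is_ran m)%:R).
Definition p_fin n : R := expect (law n) (fun m => (is_fin m)%:R).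

Lemma p_finE n : p_fin n = 1 - p_bad n.
Proof.
rewrite -(expect_law1 n) -expectB; apply: expect_ext => m.
by case: is_fin; rewrite /= ?subr0 ?subrr.
Qed.

Lemma p_ranE n : p_ran n = 1 - p_bad n - p_ker n.
Proof.
rewrite -p_finE -expectB; apply: expect_ext => -[[[] x]|] /=;
  by rewrite ?subr0 ?subrr.
Qed.

Lemma p_pos n : [/\ 0 <= p_bad n, 0 <= p_ker n & 0 <= p_ran n].
Proof.
by split; apply: (expect_ge0 (nonneg_law n) (valid_law n)) => m _; rewrite ler0n.
Qed.

Lemma p_fin_bounds n : 0 <= p_fin n <= 1.
Proof.
have [b0 k0 r0] := p_pos n; have := p_finE n; have := p_ranE n.
by move=> rE fE; apply/andP; split; lra.
Qed.

Lemma p_ran_bounds n : 0 <= p_ran n <= 1.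
Proof.
have [b0 k0 r0] := p_pos n; have := p_ranE n.
by move=> rE; apply/andP; split; lra.
Qed.

Lemma p_kerS n : p_ker n.+1 = p * p_ran n ^+ k.
Proof.
rewrite /p_ker expect_lawS /= mulr0 add0r -expect_all; congr (_ * _).
by apply: expect_ext => ms; rewrite is_ker_join.
Qed.

Lemma p_finS n : p_fin n.+1 = 1 - p + p * p_fin n ^+ k.
Proof.
rewrite /p_fin expect_lawS /= mulr1 -expect_all; congr (_ + _ * _).
by apply: expect_ext => ms; rewrite is_fin_join.
Qed.

(** With [pk_lt1] this makes the recursions [p_finS] and [p_kerS] contractions. *)
Lemma subX_le (a b : R) j : 0 <= a <= 1 -> 0 <= b <= 1 ->
  `|a ^+ j - b ^+ j| <= j%:R * `|a - b|.
Proof.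
move=> /andP[a0 a1] /andP[b0 b1]; elim: j => [|j IH]; first by rewrite subrr normr0 mul0r.
have -> : a ^+ j.+1 - b ^+ j.+1 = a * (a ^+ j - b ^+ j) + (a - b) * b ^+ j.
  by rewrite !exprS; ring.
apply: le_trans (ler_normD _ _) _; rewrite !normrM -natr1 mulrDl mul1r.
apply: lerD; last by rewrite ler_piMr // ger0_norm ?exprn_ge0 // exprn_ile1.
by apply: le_trans IH; rewrite ler_piMl // ger0_norm.
Qed.

Let theta := p * k%:R.
Lemma theta_ge0 : 0 <= theta. Proof. by rewrite mulr_ge0 // ltW. Qed.

Lemma p_bad_le n : p_bad n <= theta ^+ n.
Proof.
elim: n => [|n IH].
  by rewrite /p_bad expect_law0 expr0.
have [b0 k0 r0] := p_pos n.
have -> : p_bad n.+1 = p * (1 - p_fin n ^+ k).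
  have := p_finE n.+1; rewrite p_finS => e; lra.
rewrite exprS -mulrA; apply: ler_wpM2l; first exact: ltW.
apply: le_trans (ler_norm _) _.
have i1 : 0 <= (1 : R) <= 1 by rewrite ler01 lexx.
have := subX_le k i1 (p_fin_bounds n).
rewrite expr1n (_ : 1 - p_fin n = p_bad n); last by rewrite p_finE; ring.
by move/le_trans; apply; rewrite ger0_norm // ler_wpM2l.
Qed.

(** A rate strictly between [theta] and 1: the recursion for [p_ker] contracts by [theta] but is
    also fed by cut-off errors of order [theta ^+ n], and the gap absorbs them. *)
Definition rho := (1 + theta) / 2.
Lemma rho_bounds : [/\ 0 <= rho, theta < rho & rho < 1].
Proof. by have := theta_ge0; have := pk_lt1; rewrite -/theta /rho; split; lra. Qed.

Variable alpha : R.
Hypothesis alphaE : alpha = p * (1 - alpha) ^+ k.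
Hypothesis alpha_bounds : 0 <= alpha <= 1.

Lemma p_bad_rho n : p_bad n <= rho ^+ n.
Proof.
have [r0 tr r1] := rho_bounds; apply: le_trans (p_bad_le n) _.
by rewrite lerXn2r ?nnegrE ?theta_ge0 // ltW.
Qed.

Lemma p_ker_cvg : exists2 C : R, 0 <= C & forall n, `|p_ker n - alpha| <= C * rho ^+ n.
Proof.
have [r0 tr r1] := rho_bounds; have /andP[a0 a1] := alpha_bounds.
(* This is rho / (rho - theta), so that [theta * (C + 1) <= C * rho] closes the induction. *)
pose C := 1 + theta / (rho - theta).
have d0 : 0 < rho - theta by rewrite subr_gt0.
have C1 : 1 <= C by rewrite lerDl divr_ge0 ?theta_ge0 // ltW.
have Crec : theta * (C + 1) <= C * rho.
  have : C * (rho - theta) = rho by rewrite /C; field; rewrite gt_eqF.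
  by have := tr; lra.
exists C; first by rewrite (le_trans ler01).
elim=> [|n IH].
  rewrite /p_ker expect_law0 /= sub0r normrN ger0_norm // expr0 mulr1.
  exact: le_trans a1 C1.
rewrite p_kerS {1}alphaE -mulrBr normrM (ger0_norm (ltW p_gt0)).
have [b0 k0 q0] := p_pos n; have qE := p_ranE n.
have i2 : 0 <= 1 - alpha <= 1 by apply/andP; split; lra.
have := subX_le k (p_ran_bounds n) i2; have := p_bad_rho n; move: IH.
set x := `|p_ker n - _|; set B := rho ^+ n => IH bB.
have : `|p_ran n - (1 - alpha)| <= x + p_bad n.
  rewrite qE; have -> : 1 - p_bad n - p_ker n - (1 - alpha) = - (p_ker n - alpha) - p_bad n.
    by ring.
  by apply: le_trans (ler_normB _ _) _; rewrite normrN (ger0_norm b0).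
set y := `|_ - _|; set z := `|_ - _| => yx zy.
rewrite exprS -/B; have B0 : 0 <= B by rewrite exprn_ge0.
have : p * z <= theta * ((C + 1) * B).
  rewrite /theta -mulrA ler_wpM2l ?(ltW p_gt0) //; apply: le_trans zy _.
  by rewrite ler_wpM2l //; lra.
have := ler_wpM2r B0 Crec; lra.
Qed.

Lemma all_ran_iid n j : all (fun x => all valid x.2) (iid (law n) j).
Proof. exact/all_iid/valid_law. Qed.

(* A message that is not cut off at depth n is the same at depth n + 1. *)
Lemma expect_law_mono n (F : msg -> R) : F None = 0 -> (forall m, valid m -> 0 <= F m) ->
  expect (law n) F <= expect (law n.+1) F.
Proof.
have iid_mono D D' (Q : seq msg -> R) j : nonneg D -> nonneg D' ->
    all (fun x => valid x.2) D -> all (fun x => valid x.2) D' ->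
    (forall F, F None = 0 -> (forall m, valid m -> 0 <= F m) -> expect D F <= expect D' F) ->
    (forall ms, ~~ all is_fin ms -> Q ms = 0) -> (forall ms, all valid ms -> 0 <= Q ms) ->
    expect (iid D j) Q <= expect (iid D' j) Q.
  move=> D0 D0' vD vD' DD'; elim: j Q => [|j IH] Q Q0 Qp; first by rewrite !expect_iid0.
  rewrite !expect_iidS.
  apply: (@le_trans _ _ (expect D' (fun x => expect (iid D j) (fun xs => Q (x :: xs))))).
    apply: DD' => [|m vm].
      by rewrite /expect big1 // => x _; rewrite Q0 ?mulr0.
    apply: (expect_ge0 (nonneg_iid j D0) (all_iid j vD)) => ms vms.
    by apply: Qp; rewrite /= vm.
  apply: (ler_expect_in D0' vD') => m vm; apply: IH => ms.
    by move=> nf; rewrite Q0 //= negb_and nf orbT.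
  by move=> vms; apply: Qp; rewrite /= vm.
elim: n F => [|n IH] F F0 Fp.
  rewrite expect_law0 F0.
  exact: (expect_ge0 (nonneg_law 1) (valid_law 1)).
rewrite [leLHS]expect_lawS [leRHS]expect_lawS lerD2l ler_wpM2l ?(ltW p_gt0) //.
apply: (iid_mono _ _ _ k (nonneg_law n) (nonneg_law n.+1) (valid_law n) (valid_law n.+1) IH)
  => [ms nf|ms vms].
  by rewrite /join (negbTE nf).
exact/Fp/valid_join.
Qed.

Lemma expect_law_step n (F : msg -> R) : F None = 0 -> (forall m, valid m -> 0 <= F m <= 1) ->
  expect (law n) F <= expect (law n.+1) F <= expect (law n) F + p_bad n.
Proof.
move=> F0 F01; apply/andP; split.
  by apply: expect_law_mono => // m /F01/andP[].
have := @expect_law_mono n (fun m => (is_fin m)%:R - F m); rewrite F0 subr0 !expectB.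
rewrite -!/(p_fin _) !p_finE => /(_ erefl) H.
have := p_pos n.+1 => -[b0 _ _].
have : 1 - p_bad n - expect (law n) F <= 1 - p_bad n.+1 - expect (law n.+1) F.
  apply: H => -[m|] v; first by rewrite subr_ge0; have /andP[] := F01 _ v.
  by rewrite F0 subr0.
lra.
Qed.

(** The branch carrying kernel mass is the one of depth n in [edge1] and the one of depth n + 1 in
    [edge2]. *)
Let edge1 n := expect (law n) (fun m => expect (law n.+1) (fun b => edge m b)).
Let edge2 n := expect (law n) (fun m => expect (law n.+1) (fun b => edge b m)).

(* The two branches across an edge are independent, with laws [law n] and
   [law n.+1]; exchanging them costs at most the probability of a cut-off. *)
Lemma edge_exchange n : `|edge2 n - edge1 n| <= p_bad n.
Proof.
(* With depth n on both sides the exchange is exact; both means lie between [c] and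
   [c + p_bad n]. *)
pose c := expect (law n) (fun m => expect (law n) (fun b => edge m b)).
have cE : c = expect (law n) (fun m => expect (law n) (fun b => edge b m)).
  exact: expect_swap.
have aux (f : msg -> msg -> R) : (forall m, f m None = 0) ->
    (forall m b, valid m -> valid b -> 0 <= f m b <= 1) ->
    expect (law n) (fun m => expect (law n) (f m)) <=
      expect (law n) (fun m => expect (law n.+1) (f m)) <=
      expect (law n) (fun m => expect (law n) (f m)) + p_bad n.
  move=> f0 f1; have E : p_bad n = expect (law n) (fun=> p_bad n).
    rewrite -[LHS]mulr1 -(expect_law1 n) -expectZ; apply: expect_ext => m.
    by rewrite mulr1.
  have st m : valid m -> expect (law n) (f m) <= expect (law n.+1) (f m) <=
      expect (law n) (f m) + p_bad n.
    by move=> vm; apply: expect_law_step => // b vb; apply: f1.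
  rewrite E -expectD.
  by apply/andP; split; apply: (ler_expect_in (nonneg_law n) (valid_law n)) => m /st/andP[].
have /andP[l1 u1] : c <= edge1 n <= c + p_bad n.
  by apply: aux => [m|m b vm vb]; rewrite ?edge_None ?edge_bounds.
have /andP[l2 u2] : c <= edge2 n <= c + p_bad n.
  rewrite cE; apply: (aux (fun m b => edge b m)) => [m|m b vm vb];
  by rewrite ?edge_None ?edge_bounds.
by rewrite ler_norml; lra.
Qed.

(** Passage from a vertex to an edge: once one of the K branches at an open vertex is singled out,
    the vertex with the other k is a branch of depth n + 1. The hypothesis discards the case where
    that vertex is absent. *)
Lemma expect_iid_edge n (f : msg -> msg -> R) : (forall m, f m (Some (false, 0)) = 0) ->
  p * expect (iid (law n) K) (remsum (fun m l => f m (join l))) =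
  K%:R * expect (law n) (fun m => expect (law n.+1) (f m)).
Proof.
move=> f0; rewrite expect_remsum mulrCA; congr (_ * _); rewrite -expectZ.
by apply: expect_ext => m; rewrite expect_lawS f0 mulr0 add0r.
Qed.

Definition root_mean n : R := expect (iid (law n) K) root_val.

Lemma root_mean_edge n : p * root_mean n = p * p_ran n ^+ K - K%:R * edge2 n.
Proof.
rewrite -(@expect_iid_edge n (fun m b => edge b m)); last by move=> m; rewrite /edge.
rewrite -mulrBr -expect_all -expectB; congr (_ * _).
by apply: (expect_eq_in (all_ran_iid n K)) => ms v; rewrite root_valE.
Qed.

(** Averaging [remsum_edge] removes the weights; only probabilities are left. *)
Lemma edge1E n : K%:R * edge1 n =
  p * p_fin n ^+ K - p * p_ran n ^+ K - K%:R * p_ker n * p_ker n.+1.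
Proof.
rewrite -(@expect_iid_edge n edge); last first.
  by move=> m; rewrite /edge /= mulr0 mul0r if_same.
have ker_ran : expect (law n) (fun m => expect (iid (law n) k)
    (fun l => (is_ker m && all is_ran l)%:R)) = p_ker n * p_ran n ^+ k.
  rewrite -expect_all /p_ker mulrC -expectZ; apply: expect_ext => m.
  rewrite mulrC -expectZ; apply: expect_ext => ms.
  by case: (is_ker m); rewrite ?mul1r ?mul0r.
have -> : K%:R * p_ker n * p_ker n.+1 = p * expect (iid (law n) K)
    (remsum (fun m l => (is_ker m && all is_ran l)%:R)).
  by rewrite expect_remsum ker_ran p_kerS; ring.
rewrite -!mulrBr -!expect_all -!expectB; congr (_ * _).
by apply: (expect_eq_in (all_ran_iid n K)) => ms v; rewrite remsum_edge.
Qed.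

(** Obtained from [root_mean_edge] and [edge1E] by setting [edge2 = edge1], [p_fin = 1],
    [p_ran = 1 - alpha] and [p_ker = alpha]. *)
Definition limit_dim := 2 * p * (1 - alpha) ^+ K - p + K%:R * alpha ^+ 2.

Lemma root_mean_cvg (e : R) : 0 < e -> exists n,
  `|p * root_mean n - limit_dim| <= e /\ p * (1 - p_fin n ^+ K) <= e.
Proof.
move=> e0; have [r0 tr r1] := rho_bounds; have /andP[a0 a1] := alpha_bounds.
have [C C0 HC] := p_ker_cvg.
have K0 : 0 <= K%:R :> R by [].
(* The four terms bound, in order, the errors in [p_ran], in [p_fin], in the product of the two
   [p_ker], and in the exchange. *)
pose M := 2 * K%:R * (C + 1) + K%:R + K%:R * (2 * C) + K%:R.
have M0 : 0 <= M by rewrite /M !addr_ge0 // !mulr_ge0 // addr_ge0.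
have [n Hn] : exists n, M * rho ^+ n <= e.
  have := @cvg_expr R rho; rewrite ger0_norm // => /(_ r1).
  move=> /cvgrPdist_le /(_ (e / (M + 1))) H.
  have d0 : 0 < e / (M + 1) by rewrite divr_gt0 // ltr_wpDl.
  have [N _ HN] := H d0; exists N.
  have := HN N (leqnn N); rewrite sub0r normrN ger0_norm ?exprn_ge0 // => HN'.
  apply: le_trans (_ : M * (e / (M + 1)) <= _); first by rewrite ler_wpM2l.
  by rewrite mulrA ler_pdivrMr ?ltr_wpDl // mulrC ler_wpM2l ?(ltW e0) // lerDl.
exists n; have [b0 k0 q0] := p_pos n.
have [b0' k0' q0'] := p_pos n.+1.
have qE := p_ranE n; have qE' := p_ranE n.+1; have fE := p_finE n.
have bB := p_bad_rho n; have := HC n; have := HC n.+1.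
have /andP[B0 B1] : 0 <= rho ^+ n <= 1 by rewrite exprn_ge0 // exprn_ile1 // ltW.
rewrite exprS; move: Hn bB B0 B1; set B := rho ^+ n => Hn bB B0 B1 H1 H0.
have H1' : `|p_ker n.+1 - alpha| <= C * B.
  by apply: le_trans H1 _; rewrite ler_wpM2l // ler_piMl // ltW.
have fin1 : 1 - p_fin n ^+ K <= K%:R * B.
  have i1 : 0 <= (1 : R) <= 1 by rewrite ler01 lexx.
  have := subX_le K i1 (p_fin_bounds n); rewrite expr1n => /(le_trans (ler_norm _))/le_trans.
  by apply; rewrite ler_wpM2l // ger0_norm; lra.
have p1 := ltW p_lt1; have p0 := ltW p_gt0.
have fin0 : 0 <= 1 - p_fin n ^+ K by rewrite subr_ge0 exprn_ile1 //; lra.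
have ran1 : `|p_ran n ^+ K - (1 - alpha) ^+ K| <= K%:R * (C + 1) * B.
  have i2 : 0 <= 1 - alpha <= 1 by apply/andP; split; lra.
  apply: le_trans (subX_le K (p_ran_bounds n) i2) _.
  rewrite -mulrA ler_wpM2l // qE.
  have -> : 1 - p_bad n - p_ker n - (1 - alpha) = - (p_ker n - alpha) - p_bad n by ring.
  by apply: le_trans (ler_normB _ _) _; rewrite normrN (ger0_norm b0); lra.
have ker1 : `|p_ker n * p_ker n.+1 - alpha ^+ 2| <= 2 * C * B.
  have -> : p_ker n * p_ker n.+1 - alpha ^+ 2 =
    p_ker n * (p_ker n.+1 - alpha) + alpha * (p_ker n - alpha) by ring.
  apply: le_trans (ler_normD _ _) _; rewrite !normrM (ger0_norm k0) (ger0_norm a0).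
  have -> : 2 * C * B = C * B + C * B by ring.
  apply: lerD; [apply: le_trans H1' | apply: le_trans H0]; rewrite ler_piMl //; lra.
have KC : 0 <= K%:R * C by rewrite mulr_ge0.
split; last first.
  apply: le_trans (_ : K%:R * B <= _).
    by apply: le_trans fin1; rewrite ler_piMl.
  by apply: le_trans Hn; rewrite ler_wpM2r // /M; lra.
have := edge_exchange n; set E1 := edge1 n; set E2 := edge2 n => E12.
have -> : p * root_mean n - limit_dim =
    2 * p * (p_ran n ^+ K - (1 - alpha) ^+ K) + p * (1 - p_fin n ^+ K) +
    K%:R * (p_ker n * p_ker n.+1 - alpha ^+ 2) - K%:R * (E2 - E1).
  rewrite root_mean_edge mulrBr -/E2 [in RHS](mulrBr K%:R E2) edge1E /limit_dim.
  ring.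
apply: le_trans Hn.
have -> : M * B = 2 * (K%:R * (C + 1) * B) + K%:R * B + K%:R * (2 * C * B) + K%:R * B.
  by rewrite /M; ring.
apply: le_trans (ler_normB _ _) _; apply: lerD; last first.
  by rewrite normrM (ger0_norm K0) ler_wpM2l //; apply: le_trans E12 bB.
apply: le_trans (ler_normD _ _) _; apply: lerD; last first.
  by rewrite normrM (ger0_norm K0) ler_wpM2l.
apply: le_trans (ler_normD _ _) _; apply: lerD; last first.
  by rewrite ger0_norm ?mulr_ge0 //; apply: le_trans fin1; rewrite ler_piMl.
have p20 : 0 <= 2 * p by rewrite mulr_ge0.
rewrite normrM (ger0_norm p20); apply: le_trans (ler_wpM2l p20 ran1) _.
have : 0 <= K%:R * (C + 1) * B by rewrite !mulr_ge0 // addr_ge0.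
by move=> h; have := ler_wpM2r h p1; lra.
Qed.

End Law.

(** * The lamplighter operator as a percolation operator *)

Section RightAverages.
Variables (R : realType) (G : groupType).
Local Notation C := R[i].
Local Notation l2 := (l2 R G).
Implicit Types (f h : l2) (g x : G).

Fact l2_rshift_subproof g f : (fun x => f (x * g)%g) \in @sqsummable R G.
Proof.
apply/sqsummableE; apply: (reindex_rsummable _ _ (l2_summable f)).
  exact: (mulgK g).
exact: (mulgVK g).
Qed.

Definition l2_rshift g f : l2 := L2 (l2_rshift_subproof g f).

Lemma l2_rshiftE g f x : l2_rshift g f x = f (x * g)%g. Proof. by []. Qed.

Lemma l2_rshift_linear g : linear (l2_rshift g).
Proof. by move=> a f h; apply: l2P. Qed.

Lemma l2_rshiftM g1 g2 f : l2_rshift (g1 * g2)%g f = l2_rshift g1 (l2_rshift g2 f).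
Proof. by apply: l2P => x; rewrite !l2_rshiftE mulgA. Qed.

Lemma l2dot_rshift g f h : l2dot (l2_rshift g f) h = l2dot f (l2_rshift g^-1 h).
Proof.
have mK := @mulgK G g; have mVK := @mulgVK G g.
apply: complexP; rewrite ?Re_dot ?Im_dot.
all: rewrite -[LHS](@reindex_rsum _ _ _ (fun x => x * g^-1)%g (fun x => x * g)%g) //.
all: by congr rsum; apply/funext => x; rewrite !l2_rshiftE mulgVK.
Qed.

Lemma l2_shift_rshift g1 g2 f : l2_shift g1 (l2_rshift g2 f) = l2_rshift g2 (l2_shift g1 f).
Proof. by apply: l2P => x; rewrite !(l2_rshiftE, l2_shiftE) mulgA. Qed.

Lemma l2_shift_point g x : l2_shift g (l2_point R x) = l2_point R (g * x)%g.
Proof.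
apply: l2P => y; rewrite l2_shiftE /=; congr (nat_of_bool _)%:R.
by apply/eqP/eqP => [<-|->]; rewrite ?mulVKg ?mulKg.
Qed.

Lemma l2_rshift_point g x : l2_rshift g (l2_point R x) = l2_point R (x * g^-1)%g.
Proof.
apply: l2P => y; rewrite l2_rshiftE /=; congr (nat_of_bool _)%:R.
by apply/eqP/eqP => [<-|->]; rewrite ?mulgK ?mulgVK.
Qed.

Variables (H : finGroupType) (k : H -> G).
Hypothesis kM : forall a b, k (a * b)%g = (k a * k b)%g.

Lemma hom1 : k 1%g = 1%g.
Proof. by apply: (mulgI (k 1%g)); rewrite -kM !mulg1. Qed.
Lemma homV a : k a^-1%g = (k a)^-1%g.
Proof. by apply: (mulgI (k a)); rewrite -kM !mulgV hom1. Qed.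

Definition ravg f : l2 := (#|H|%:R)^-1 *: \sum_(a : H) l2_rshift (k a) f.

Lemma ravgE f x : ravg f x = (#|H|%:R)^-1 * \sum_(a : H) f (x * k a)%g.
Proof. by rewrite /ravg l2funZ l2fun_sum. Qed.

Lemma ravg_linear : linear ravg.
Proof.
move=> a f h; rewrite /ravg scalerA mulrC -scalerA -scalerDr; congr (_ *: _).
rewrite [X in _ = X + _]scaler_sumr -big_split.
by apply: eq_bigr => b _; rewrite l2_rshift_linear.
Qed.

Lemma conj_invn n : ((n%:R : C)^-1)^*%C = n%:R^-1.
Proof.
have -> : (n%:R : C)^-1 = ((n%:R : R)^-1)%:C%C by rewrite fmorphV rmorph_nat.
by apply: complexP; rewrite ?ReJ ?ImJ //= oppr0.
Qed.

Lemma ravg_sa f h : l2dot (ravg f) h = l2dot f (ravg h).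
Proof.
rewrite l2dotZl l2dotZr conj_invn l2dot_suml l2dot_sumr; congr (_ * _).
rewrite [RHS](reindex_inj invg_inj); apply: eq_bigr => a _.
by rewrite l2dot_rshift homV.
Qed.

Lemma card_neq0 : (#|H|%:R : C) != 0.
Proof. by rewrite pnatr_eq0 -lt0n; apply/card_gt0P; exists 1%g. Qed.

Lemma ravg_idem f : ravg (ravg f) = ravg f.
Proof.
rewrite {1}/ravg; have -> : \sum_(a : H) l2_rshift (k a) (ravg f) = \sum_(a : H) ravg f.
  apply: eq_bigr => a _; rewrite {1}/ravg (linZ (l2_rshift_linear _)); congr (_ *: _).
  rewrite (lin_sum (l2_rshift_linear _)) [RHS](reindex_inj (mulgI a)).
  by apply: eq_bigr => b _; rewrite kM l2_rshiftM.
apply: l2P => x; rewrite l2funZ sumr_const -[ravg f *+ _]scaler_nat l2funZ mulrA.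
by rewrite mulVf ?mul1r // card_neq0.
Qed.

Lemma ravg_shift g f : ravg (l2_shift g f) = l2_shift g (ravg f).
Proof.
rewrite /ravg (linZ (l2_shift_linear g)) (lin_sum (l2_shift_linear g)).
by congr (_ *: _); apply: eq_bigr => a _; rewrite -l2_shift_rshift.
Qed.

(** Right translations commute with left ones. *)
Lemma ravg_conv T f : is_conv T -> ravg (T f) = T (ravg f).
Proof.
move=> [a Ta]; rewrite !Ta /lconv (lin_sum ravg_linear); apply: eq_bigr => g _.
by rewrite (linZ ravg_linear) ravg_shift.
Qed.

End RightAverages.

Lemma ravgC (R : realType) (G : groupType) (H1 H2 : finGroupType)
    (k1 : H1 -> G) (k2 : H2 -> G) (f : l2 R G) :
  (forall a b, k1 a * k2 b = k2 b * k1 a)%g -> ravg k1 (ravg k2 f) = ravg k2 (ravg k1 f).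
Proof.
move=> comm; apply: l2P => x; rewrite !ravgE.
under eq_bigr do rewrite ravgE.
under [in RHS]eq_bigr do rewrite ravgE.
rewrite -!mulr_sumr mulrCA exchange_big; congr (_ * (_ * _)).
by apply: eq_bigr => a _; apply: eq_bigr => b _; rewrite -!mulgA comm.
Qed.

(** * Lamp switches acting from the right *)

Section LampSwitches.
Variables (d m : nat).
Local Notation F := (free_group 'I_d).
Local Notation Gm := (lamplighter d m).
Local Notation inF := (@wr_inr 'Z_m F : F -> Gm).
Local Notation inC := (@wr_inl 'Z_m F : 'Z_m -> Gm).
Implicit Types (z x y : F) (a b : 'Z_m) (g : Gm).

Lemma inCM a b : inC (a * b)%g = (inC a * inC b)%g.
Proof.
congr pair; rewrite /= ?mulg1 //; apply/fsfunP => x.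
by rewrite lamps_mulE lamps_shiftE !lamps_deltaE invg1 mul1g; case: eqP; rewrite ?mulg1.
Qed.

Lemma inFM x y : inF (x * y)%g = (inF x * inF y)%g.
Proof.
congr pair; apply/fsfunP => z.
by rewrite lamps_mulE lamps_shiftE !lamps_oneE mulg1.
Qed.

Lemma inFV x : inF x^-1%g = (inF x)^-1%g.
Proof. by apply: (mulgI (inF x)); rewrite -inFM !mulgV. Qed.

(* Right multiplication of (eta, x) by [switch z a] acts on the lamp at x z^-1. *)
Definition switch z a : Gm := ((inF z)^-1 * inC a * inF z)%g.

Lemma switchM z a b : switch z (a * b)%g = (switch z a * switch z b)%g.
Proof. by rewrite /switch inCM !mulgA mulgK. Qed.

Lemma switch2 g z a : (g * switch z a)%g.2 = g.2.
Proof.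
rewrite /switch -inFV; change (g.2 * (z^-1 * 1 * z) = g.2)%g.
by rewrite mulg1 mulVg mulg1.
Qed.

Lemma switch1 g z a x : (g * switch z a)%g.1 x =
  (g.1 x * if (g.2^-1 * x == z^-1) then a else 1)%g.
Proof.
rewrite /switch -inFV.
change (lamps_mul g.1 (lamps_shift g.2 (lamps_mul (lamps_mul (lamps_one _ _)
  (lamps_shift z^-1 (lamps_delta F a))) (lamps_shift (z^-1 * 1) (lamps_one _ _)))) x =
  (g.1 x * if (g.2^-1 * x == z^-1) then a else 1))%g.
rewrite lamps_mulE; congr (_ * _)%g; rewrite lamps_shiftE !lamps_mulE !lamps_shiftE.
rewrite !lamps_oneE lamps_deltaE mul1g mulg1 invgK; congr (if _ then _ else _).
by apply/eqP/eqP => [|->]; [move/(canRL (mulKg _)); rewrite mulg1 | rewrite mulgV].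
Qed.

(** Distinct positions concern distinct lamps, and at a common position the lamp group is
    abelian. *)
Lemma switchC z1 z2 a b : (switch z1 a * switch z2 b = switch z2 b * switch z1 a)%g.
Proof.
have s1 (u : F) c : (switch u c).2 = 1%g by rewrite -[switch u c]mul1g switch2.
have e (u v : F) c c' x : (switch u c * switch v c')%g.1 x =
    ((if x == u^-1 then c else 1) * (if x == v^-1 then c' else 1))%g.
  rewrite switch1 s1 invg1 mul1g; congr (_ * _)%g.
  by rewrite -[switch u c]mul1g switch1 invg1 mul1g lamps_oneE mul1g.
apply/eqP; rewrite -pair_eqE; apply/andP; split; apply/eqP.
  by apply/fsfunP => x; rewrite !e Zp_mulgC.
by rewrite !switch2 !s1.
Qed.

End LampSwitches.

Section LampOperator.
Variables (R : realType) (d m : nat).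
Hypothesis m_gt1 : (1 < m)%N.
Local Notation C := R[i].
Local Notation F := (free_group 'I_d).
Local Notation Gm := (lamplighter d m).
Local Notation inF := (@wr_inr 'Z_m F : F -> Gm).
Local Notation inC := (@wr_inl 'Z_m F : 'Z_m -> Gm).
Local Notation l2 := (l2 R Gm).
Implicit Types (z x y : F) (a b : 'Z_m) (g : Gm) (f : l2) (c : 'I_d * bool).

Definition lampop : l2 -> l2 := lconv (@ratr C) (lampETE d m).
Definition lamp_avg z : l2 -> l2 := ravg (@switch d m z).
Definition site z : l2 := l2_point R (inF z).

Definition letter_elt c : F := @FreeGroup _ [:: c] isT.

Lemma letter_elt_genV i : letter_elt (i, false) = (fg_gen i)^-1%g.
Proof. exact: val_inj. Qed.
Lemma letter_eltV c : (letter_elt c)^-1%g = letter_elt (letter_inv c).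
Proof. exact: val_inj. Qed.

Lemma sum_letters (V : nmodType) (f : 'I_d * bool -> V) :
  \sum_c f c = \sum_(i < d) (f (i, true) + f (i, false)).
Proof.
rewrite (eq_bigr (fun c => f (c.1, c.2))); last by case.
rewrite -(pair_bigA _ (fun i (b : bool) => f (i, b))) /=.
by apply: eq_bigr => i _; rewrite big_bool.
Qed.

Let ratC : {rmorphism rat -> C} := @ratr C.

Definition lampE_op f : l2 := (m%:R)^-1 *: \sum_(a : 'Z_m) l2_shift (inC a) f.
Definition lampT_op f : l2 := \sum_c l2_shift (inF (letter_elt c)) f.

Lemma lconv_lampE f : lconv (@ratr C) (lampE d m) f = lampE_op f.
Proof.
rewrite /lampE (lconvZ ratC) (lconv_sum ratC) fmorphV rmorph_nat; congr (_ *: _).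
by apply: eq_bigr => a _; rewrite (lconvU ratC) rmorph1 scale1r.
Qed.

Lemma lconv_lampT f : lconv (@ratr C) (lampT d m) f = lampT_op f.
Proof.
rewrite /lampT (lconv_sum ratC) /lampT_op sum_letters; apply: eq_bigr => i _.
have pointE (u : Gm) : lconv (@ratr C) (<< u >> : {malg rat[Gm]}) f = l2_shift u f.
  by rewrite (lconvU ratC) rmorph1 scale1r.
rewrite (lconvD ratC); congr (_ + _).
  exact: pointE.
rewrite letter_elt_genV inFV.
exact: pointE.
Qed.

Lemma lampopE f : lampop f = lampE_op (lampT_op (lampE_op f)).
Proof. by rewrite /lampop /lampETE !(lconv_mul ratC) !lconv_lampE lconv_lampT. Qed.

Lemma lampE_conv : is_conv lampE_op.
Proof. by apply/is_convZ/is_conv_sum => a; exact: is_conv_shift. Qed.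
Lemma lampT_conv : is_conv lampT_op.
Proof. by apply: is_conv_sum => a; exact: is_conv_shift. Qed.
Lemma lampop_conv : is_conv lampop.
Proof.
have [a Ha] := is_conv_comp lampE_conv (is_conv_comp lampT_conv lampE_conv).
by exists a => f; rewrite lampopE Ha.
Qed.

Lemma lampE_sa f h : l2dot (lampE_op f) h = l2dot f (lampE_op h).
Proof.
rewrite l2dotZl l2dotZr conj_invn l2dot_suml l2dot_sumr; congr (_ * _).
rewrite [RHS](reindex_inj invg_inj); apply: eq_bigr => a _.
by rewrite l2dot_shift (homV (@inCM d m)).
Qed.

Lemma lampT_sa f h : l2dot (lampT_op f) h = l2dot f (lampT_op h).
Proof.
have inv_inj : injective (@letter_inv 'I_d) by exact/inv_inj/letter_invK.
rewrite l2dot_suml l2dot_sumr [RHS](reindex_inj inv_inj); apply: eq_bigr => c _.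
by rewrite l2dot_shift -inFV letter_eltV.
Qed.

Lemma lampop_sa f h : l2dot (lampop f) h = l2dot f (lampop h).
Proof. by rewrite !lampopE lampE_sa lampT_sa lampE_sa. Qed.

Lemma lamp_avg_linear z : linear (lamp_avg z). Proof. exact: ravg_linear. Qed.
Lemma lamp_avg_sa z f h : l2dot (lamp_avg z f) h = l2dot f (lamp_avg z h).
Proof. exact/ravg_sa/switchM. Qed.
Lemma lamp_avg_idem z f : lamp_avg z (lamp_avg z f) = lamp_avg z f.
Proof. exact/ravg_idem/switchM. Qed.
Lemma lamp_avgC z y f : lamp_avg z (lamp_avg y f) = lamp_avg y (lamp_avg z f).
Proof. by apply: ravgC => a b; exact: switchC. Qed.
Lemma lamp_avg_conv T z f : is_conv T -> lamp_avg z (T f) = T (lamp_avg z f).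
Proof. exact: ravg_conv. Qed.

Lemma card_lamps : #|'Z_m| = m.
Proof. by rewrite card_ord Zp_cast. Qed.

(** Moving h past z turns it into the conjugate z^-1 h z on the right. *)
Lemma lampE_site z : lampE_op (site z) = lamp_avg z (site z).
Proof.
rewrite /lampE_op /lamp_avg /ravg card_lamps; congr (_ *: _).
rewrite [RHS](reindex_inj invg_inj); apply: eq_bigr => a _.
rewrite l2_shift_point l2_rshift_point (homV (@switchM d m z)) invgK.
by rewrite /switch !mulgA mulgV mul1g.
Qed.

(* Averaging a site over its left lamp coset is a right average, and right
   averages commute with convolutions: on sites the lamplighter operator acts as
   the adjacency operator of a percolation cluster, where [lamp_avg z] plays the
   role of the indicator that z is open. *)
Lemma lampop_site z : lampop (site z) =
  \sum_c lamp_avg (letter_elt c * z)%g (lamp_avg z (site (letter_elt c * z)%g)).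
Proof.
rewrite lampopE lampE_site -(lamp_avg_conv z _ lampT_conv) -(lamp_avg_conv z _ lampE_conv).
rewrite /lampT_op (lin_sum (is_conv_linear lampE_conv)) (lin_sum (lamp_avg_linear z)).
apply: eq_bigr => c _.
by rewrite l2_shift_point -inFM -/(site _) lampE_site lamp_avgC.
Qed.

(** Vanishing on the whole fibre over the unit of the free group, rather than only at the unit of
    the wreath product, is stable under averages because switches leave the second coordinate
    alone. *)
Definition off_unit f : Prop := forall g, g.2 = 1%g -> f g = 0.

Lemma off_unitD f h : off_unit f -> off_unit h -> off_unit (f + h).
Proof. by move=> f0 h0 g g1; rewrite l2funD f0 ?h0 ?addr0. Qed.
Lemma off_unitZ (k : C) f : off_unit f -> off_unit (k *: f).
Proof. by move=> f0 g g1; rewrite l2funZ f0 ?mulr0. Qed.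
Lemma off_unitB f h : off_unit f -> off_unit h -> off_unit (f - h).
Proof. by move=> f0 h0; rewrite -scaleN1r; apply/off_unitD/off_unitZ. Qed.
Lemma off_unit_avg z f : off_unit f -> off_unit (lamp_avg z f).
Proof.
by move=> f0 g g1; rewrite /lamp_avg ravgE big1 ?mulr0 // => a _; rewrite f0 // switch2.
Qed.
Lemma off_unit_site z : z != 1%g -> off_unit (site z).
Proof.
move=> z1 g g1 /=; case: eqP => // gz; move/eqP: z1; case.
by rewrite -g1 gz.
Qed.
Lemma off_unit_dot f : off_unit f -> l2dot f (site 1%g) = 0.
Proof. by move=> f0; rewrite l2dot_point f0. Qed.

End LampOperator.

(** * Exploration of the cluster of the unit *)

Section Exploration.
Variables (R : realType) (d m : nat).
Hypothesis m_gt1 : (1 < m)%N.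
Local Notation C := R[i].
Local Notation F := (free_group 'I_d).
Local Notation Gm := (lamplighter d m).
Local Notation l2 := (l2 R Gm).
Local Notation T := (@lampop R d m).
Local Notation avg := (@lamp_avg R d m).
Local Notation site := (@site R d m).
Local Notation off_unit := (@off_unit R d m).
Local Notation config := (seq (F * bool)).
Implicit Types (z x y : F) (g : Gm) (f h : l2) (s e : config) (c : 'I_d * bool).

Let p : R := m%:R^-1.

(** The projection onto the event that the listed sites are open ([true]) or closed ([false]). *)
Fixpoint restrict s f : l2 :=
  if s is (z, b) :: s' then
    if b then avg z (restrict s' f) else restrict s' f - avg z (restrict s' f)
  else f.

Lemma restrict_cat e s f : restrict (e ++ s) f = restrict e (restrict s f).
Proof. by elim: e => [|[z b] e IH] //=; rewrite IH. Qed.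

Lemma restrict_linear s : linear (restrict s).
Proof.
elim: s => [|[z b] s IH] a f h //=; rewrite IH (lamp_avg_linear z).
by case: b => //; rewrite opprD addrACA -scalerBr.
Qed.

Lemma restrict_avg s z f : restrict s (avg z f) = avg z (restrict s f).
Proof.
elim: s => [|[y b] s IH] //=; rewrite IH lamp_avgC.
by case: b => //; rewrite (linB (lamp_avg_linear z)).
Qed.

Lemma restrict_conv U s f : is_conv U -> restrict s (U f) = U (restrict s f).
Proof.
move=> cU; elim: s => [|[y b] s IH] //=; rewrite IH lamp_avg_conv //.
by case: b => //; rewrite (linB (is_conv_linear cU)).
Qed.

Lemma restrict_sa s f h : l2dot (restrict s f) h = l2dot f (restrict s h).
Proof.
elim: s f h => [|[y b] s IH] f h //=.
by case: b; rewrite ?l2dotBl ?l2dotBr lamp_avg_sa !IH restrict_avg.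
Qed.

Lemma restrict_idem s f : restrict s (restrict s f) = restrict s f.
Proof.
elim: s f => [|[y b] s IH] f //=.
case: b; rewrite ?(linB (restrict_linear s)) !restrict_avg IH.
  exact: lamp_avg_idem.
by rewrite (linB (lamp_avg_linear y)) lamp_avg_idem subrr subr0.
Qed.

Lemma restrict_open s z f : (z, true) \in s -> restrict s (avg z f) = restrict s f.
Proof.
elim: s => [|[y b] s IH] //=; rewrite in_cons => /predU1P[[-> <-]|/IH -> //].
by rewrite restrict_avg lamp_avg_idem.
Qed.

Lemma restrict_closed s z f : (z, false) \in s -> restrict s (avg z f) = 0.
Proof.
elim: s => [|[y b] s IH] //=; rewrite in_cons => /predU1P[[-> <-]|/IH ->].
  by rewrite restrict_avg lamp_avg_idem subrr.
by rewrite (lin0 (lamp_avg_linear y)) subrr; case: b.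
Qed.

Lemma off_unit_restrict s f : off_unit f -> off_unit (restrict s f).
Proof.
move=> f0; elim: s => [|[y b] s IH] //=.
by case: b; [|apply: off_unitB => //]; exact: off_unit_avg.
Qed.

Definition weight s : R := \prod_(x <- s) (if x.2 then p else 1 - p).

(* The lamp governed by [avg z] at position 1 sits at z^-1. *)
Let trivial_outside s f := forall g, f g != 0 ->
  g.2 = 1%g /\ forall z, z \notin unzip1 s -> g.1 z^-1%g = 1%g.

Let trivial_site : trivial_outside [::] (site 1%g).
Proof.
move=> g /=; case: (eqVneq g) => [-> _|]; last by rewrite eqxx.
by split=> // z _; rewrite lamps_oneE.
Qed.

Let trivial_cons s f z b : trivial_outside s f -> trivial_outside ((z, b) :: s) f.
Proof.
move=> sf g /sf[-> g1]; split=> // y; rewrite inE negb_or => /andP[_]; exact: g1.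
Qed.

Let trivial_avg s f z b : trivial_outside s f -> trivial_outside ((z, b) :: s) (avg z f).
Proof.
move=> sf g gf; have [a fa] : exists a, f (g * switch z a)%g != 0.
  apply/existsP; apply: contraNT gf => /existsPn h.
  by rewrite /lamp_avg ravgE big1 ?mulr0 // => a _; apply/eqP; move: (h a); rewrite negbK.
have [] := sf _ fa; rewrite switch2 => g2 g1; split=> // y.
rewrite inE negb_or => /andP[yz /g1]; rewrite switch1 g2 invg1 mul1g.
by rewrite (inj_eq invg_inj) (negbTE yz) mulg1.
Qed.

Let trivial_restrict s : trivial_outside s (restrict s (site 1%g)).
Proof.
elim: s => [|[z b] s IH] //=; case: b; first exact: trivial_avg.
move=> g; have [f0|/(trivial_cons z false IH) //] := eqVneq (restrict s (site 1%g) g) 0.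
by rewrite l2funD l2funN f0 sub0r oppr_eq0; apply: trivial_avg.
Qed.

Let avg_unit s f z : trivial_outside s f -> z \notin unzip1 s ->
  avg z f 1%g = p%:C%C * f 1%g.
Proof.
move=> sf zs; rewrite /lamp_avg ravgE card_lamps // fmorphV rmorph_nat; congr (_ * _).
rewrite (bigD1 1%g) //= big1 ?addr0; first by rewrite (hom1 (@switchM d m z)) mulg1.
move=> a a1; apply/eqP; apply: contraNT a1 => /sf[_ /(_ z zs)].
by rewrite switch1 invg1 mul1g eqxx lamps_oneE mul1g => ->.
Qed.

(** In the vector state of the unit the sites are independent: a lamp not yet inspected is trivial,
    so among its m switches only the neutral one contributes, giving the factor [p]. *)
Lemma restrict_unit s : uniq (unzip1 s) ->
  restrict s (site 1%g) 1%g = (weight s)%:C%C.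
Proof.
elim: s => [|[z b] s IH] /=; first by rewrite /weight big_nil eqxx.
move=> /andP[zs us]; rewrite /weight big_cons -/(weight s) rmorphM /= -IH //.
have e := avg_unit (@trivial_restrict s) zs.
case: b; first exact: e.
by rewrite l2funD l2funN e rmorphB rmorph1 mulrBl mul1r.
Qed.

(* The message [u] of the branch at [z], seen from its open neighbour [z0], holds
   on the range of [restrict s].  The vectors [v] and [w] live on the branch, so
   that T differs from the adjacency operator of the branch by a multiple of the
   site [z0]. *)
Definition describes s z z0 (u : msg R) : Prop :=
  match u with
  | None => True
  | Some (true, t) => exists v w, [/\ off_unit v, off_unit w,
      T v = t%:C%C *: restrict s (site z0) &
      T w = restrict s (avg z (site z)) - v]
  | Some (false, t) => exists v w, [/\ off_unit v, off_unit w,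
      T v = restrict s (avg z (site z)) &
      T w = v + t%:C%C *: restrict s (site z0)]
  end.

Let T_conv := lampop_conv R d m.
Let T_linear := is_conv_linear T_conv.

(** The rest of the exploration only adds further projections, and these commute with the
    operator. *)
Lemma describes_cat e s z z0 u : describes s z z0 u -> describes (e ++ s) z z0 u.
Proof.
have lin := restrict_linear e; case: u => [[[] t]|] //= [v [w [v0 w0 Tv Tw]]];
  exists (restrict e v), (restrict e w); split; try exact: off_unit_restrict.
- by rewrite -restrict_conv // Tv (linZ lin) restrict_cat.
- by rewrite -restrict_conv // Tw (linB lin) restrict_cat.
- by rewrite -restrict_conv // Tv restrict_cat.
by rewrite -restrict_conv // Tw (linD lin) (linZ lin) restrict_cat.
Qed.

Fixpoint describe_all s z0 (zs : seq F) (us : seq (msg R)) : Prop :=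
  match zs, us with
  | z :: zs', u :: us' => describes s z z0 u /\ describe_all s z0 zs' us'
  | [::], [::] => True
  | _, _ => False
  end.

Let rC (t : R) : C := t%:C%C.
Let rCD t u : rC (t + u) = rC t + rC u. Proof. exact: rmorphD. Qed.

Lemma describe_ran s z0 zs us : describe_all s z0 zs us -> all is_ran us ->
  exists v w, [/\ off_unit v, off_unit w,
    T v = \sum_(z <- zs) restrict s (avg z (site z)) &
    T w = v + rC (\sum_(u <- us) rval u) *: restrict s (site z0)].
Proof.
elim: zs us => [|z zs IH] [|u us] //=.
  by exists 0, 0; rewrite !big_nil (lin0 T_linear) scale0r addr0.
case: u => [[[] t]|] //= [[v [w [v0 w0 Tv Tw]]] /IH{}IH] /IH[v' [w' [v0' w0' Tv' Tw']]].
exists (v + v'), (w + w'); split; try exact: off_unitD.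
  by rewrite (linD T_linear) Tv Tv' big_cons.
by rewrite (linD T_linear) Tw Tw' big_cons rCD scalerDl addrACA.
Qed.

Lemma describe_fin s z0 zs us : describe_all s z0 zs us -> all is_fin us ->
  exists v w, [/\ off_unit v, off_unit w,
    T v = rC (\sum_(u <- us) kval u) *: restrict s (site z0) &
    T w = \sum_(z <- zs) restrict s (avg z (site z)) - v].
Proof.
elim: zs us => [|z zs IH] [|u us] //=.
  by exists 0, 0; rewrite !big_nil (lin0 T_linear) scale0r subr0.
case: u => [[[] t]|] //= [[v [w [v0 w0 Tv Tw]]] /IH{}IH] /IH[v' [w' [v0' w0' Tv' Tw']]].
  exists (v + v'), (w + w'); split; try exact: off_unitD.
    by rewrite (linD T_linear) Tv Tv' big_cons rCD scalerDl.
  by rewrite (linD T_linear) Tw Tw' big_cons opprD addrACA.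
(* A range child adds its preimage [v] to the second vector and nothing to the first, in accordance
   with its [kval] being 0. *)
exists v', (v + w'); split => //; first exact: off_unitD.
  by rewrite big_cons add0r.
by rewrite (linD T_linear) Tv Tw' big_cons addrA.
Qed.

Section Node.
Variables (s : config) (z : F) (zs : seq F) (us : seq (msg R)) (par : l2).
Hypothesis zs_us : describe_all s z zs us.
Hypothesis us_valid : all valid us.
Hypothesis T_node : T (restrict s (site z)) =
  par + \sum_(y <- zs) restrict s (avg y (site y)).

(** [par] is the contribution of the parent of [z]. For the root it is 0, and then [t (site - v)] is
    a kernel vector differing from the site by an element of the range; this is why [t] is the
    kernel mass. *)
Lemma node_ran : all is_ran us -> let t := (1 + \sum_(u <- us) rval u)^-1 in
  exists v w, [/\ off_unit v, off_unit w,
    T (rC t *: (restrict s (site z) - v)) = rC t *: par &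
    T w = restrict s (site z) - rC t *: (restrict s (site z) - v)].
Proof.
move=> ran t; have [v [w [v0 w0 Tv Tw]]] := describe_ran zs_us ran.
have t1 : 1 + \sum_(u <- us) rval u != 0 by rewrite gt_eqF // ltr_pwDl // sum_rval_ge0.
exists v, (rC t *: w); split=> //; first exact: off_unitZ.
  by rewrite (linZ T_linear) (linB T_linear) T_node Tv addrK.
rewrite (linZ T_linear) Tw scalerDr scalerA scalerBr opprB addrCA; congr (_ + _).
rewrite -[X in X - _]scale1r -scalerBl; congr (_ *: _).
rewrite -!rmorphM -(rmorph1 (real_complex R)) -rmorphB; congr (_%:C)%C.
by rewrite /t; field.
Qed.

(** Some child carries kernel mass, so its kernel vector, continued to [z], is mapped to a nonzero
    multiple of the site. *)
Lemma node_fin : all is_fin us -> ~~ all is_ran us -> let t := (\sum_(u <- us) kval u)^-1 in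
  exists v w, [/\ off_unit v, off_unit w,
    T v = restrict s (site z) & T (rC t *: (restrict s (site z) - w)) = v + rC t *: par].
Proof.
move=> fin nran t; have [v [w [v0 w0 Tv Tw]]] := describe_fin zs_us fin.
have t0 : \sum_(u <- us) kval u != 0.
  by rewrite gt_eqF // sum_kval_gt0 // ker_or_ran.
exists (rC t *: v), w; split=> //; first exact: off_unitZ.
  by rewrite (linZ T_linear) Tv scalerA -rmorphM mulVf // rmorph1 scale1r.
rewrite (linZ T_linear) (linB T_linear) T_node Tw opprB -scalerDr; congr (_ *: _).
by rewrite -addrA [X in par + X]addrC subrK addrC.
Qed.

End Node.

End Exploration.

(** * Exploration of the open cluster along reduced words *)

Section Tree.
Variables (R : realType) (d m : nat).
Hypotheses (d_gt0 : (0 < d)%N) (m_gt1 : (1 < m)%N).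
Local Notation C := R[i].
Local Notation F := (free_group 'I_d).
Local Notation Gm := (lamplighter d m).
Local Notation l2 := (l2 R Gm).
Local Notation T := (@lampop R d m).
Local Notation avg := (@lamp_avg R d m).
Local Notation site := (@site R d m).
Local Notation restrict := (@restrict R d m).
Local Notation weight := (@weight R d m).
Local Notation describes := (@describes R d m).
Local Notation describe_all := (@describe_all R d m).
Local Notation config := (seq (F * bool)).
Local Notation outcome := (config * msg R)%type.
Local Notation k := (2 * d - 1)%N.
Implicit Types (z : F) (f : l2) (s e : config) (c : 'I_d * bool) (us : seq (msg R)).

Let p : R := m%:R^-1.
Let D n := law p k n.

(** Neighbours are reached by left multiplication; the parent of [z] is [z] without its first
    letter, and the unit has no backward letter. *)
Definition backward z c := if word z is b :: _ then c == letter_inv b else false.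
Definition children z : seq F :=
  [seq (letter_elt c * z)%g | c <- enum {: 'I_d * bool} & ~~ backward z c].

Lemma word_child z c : ~~ backward z c -> word (letter_elt c * z)%g = c :: word z.
Proof.
rewrite /backward; change (~~ backward z c -> push c (word z) = c :: word z).
rewrite /backward /push; case: (word z) => // b w.
by case: (b =P letter_inv c) => // ->; rewrite letter_invK eqxx.
Qed.

Lemma sum_children (V : nmodType) z (h : F -> V) :
  \sum_c h (letter_elt c * z)%g =
  \sum_(c | backward z c) h (letter_elt c * z)%g + \sum_(y <- children z) h y.
Proof.
rewrite (bigID (backward z)) /=; congr (_ + _).
by rewrite big_map big_filter big_enum_cond.
Qed.

Lemma size_children z : z != 1%g -> size (children z) = k.
Proof.
move=> z1; rewrite size_map size_filter -[enum _]/(enum {: 'I_d * bool}).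
have : word z != [::] by apply: contra z1 => /eqP e; apply/eqP/val_inj.
rewrite /backward; case: (word z) => // b w _.
have := count_predC (pred1 (letter_inv b)) (enum {: 'I_d * bool}).
rewrite -cardE card_prod card_ord card_bool count_uniq_mem ?enum_uniq // mem_enum.
by rewrite mulnC => <-; rewrite addnC addnK.
Qed.

Lemma size_children1 : size (children 1%g) = k.+1.
Proof.
rewrite size_map size_filter /= count_predT -cardE card_prod card_ord card_bool.
by rewrite mulnC subn1 prednK // muln_gt0.
Qed.

Section List.
Variable ex : F -> config -> seq outcome.

(** Branches are explored one after another, each starting from the configuration left by the
    previous one. *)
Fixpoint explore_list (zs : seq F) s : seq (config * seq (msg R)) :=
  if zs is z :: zs' then
    flatten [seq [seq (y.1, x.2 :: y.2) | y <- explore_list zs' x.1] | x <- ex z s]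
  else [:: (s, [::])].

Lemma explore_list_cons z zs s y : y \in explore_list (z :: zs) s ->
  exists x y', [/\ x \in ex z s, y' \in explore_list zs x.1 & y = (y'.1, x.2 :: y'.2)].
Proof.
by move=> /flatten_mapP[x xs /mapP[y' ys ->]]; exists x, y'.
Qed.

Lemma explore_list_sum f zs :
  (forall z s, \sum_(x <- ex z s) restrict x.1 f = restrict s f) ->
  forall s, \sum_(x <- explore_list zs s) restrict x.1 f = restrict s f.
Proof.
move=> H; elim: zs => [|z zs IH] s; first by rewrite big_seq1.
rewrite big_flatten big_map -[RHS](H z); apply: eq_bigr => x _.
by rewrite big_map /= IH.
Qed.

Lemma explore_list_weight (E : seq (R * msg R)) zs :
  (forall z s h, z \in zs -> \sum_(x <- ex z s) weight x.1 * h x.2 = weight s * expect E h) ->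
  forall s h, \sum_(x <- explore_list zs s) weight x.1 * h x.2 =
              weight s * expect (iid E (size zs)) h.
Proof.
elim: zs => [|z zs IH] H s h; first by rewrite big_seq1 expect_iid0.
rewrite big_flatten big_map expect_iidS -(H z) ?mem_head //.
apply: eq_bigr => x _; rewrite big_map /= -IH // => y s' h' yz.
by apply: H; rewrite in_cons yz orbT.
Qed.

End List.

(** A decision tree: the outcomes split the event [s] ([explore_sum]), and their weights reproduce
    [law] ([explore_weight]). *)
Fixpoint explore n z s : seq outcome :=
  if n is n'.+1 then
    ((z, false) :: s, Some (false, 0)) ::
    [seq (x.1, join x.2) | x <- explore_list (explore n') (children z) ((z, true) :: s)]
  else [:: (s, None)].

Lemma explore_sum f n z s : \sum_(x <- explore n z s) restrict x.1 f = restrict s f.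
Proof.
elim: n z s => [|n IH] z s; first by rewrite big_seq1.
by rewrite big_cons big_map /= (explore_list_sum _ IH) /= subrK.
Qed.

Lemma weight_cons z b s : weight ((z, b) :: s) = (if b then p else 1 - p) * weight s.
Proof. by rewrite /weight big_cons. Qed.

Lemma child_neq1 z y : y \in children z -> y != 1%g.
Proof.
move=> /mapP[c]; rewrite mem_filter => /andP[bc _] ->.
by apply: contraTneq isT => /(congr1 (@word _)); rewrite word_child.
Qed.

Lemma explore_weight n z s h : z != 1%g ->
  \sum_(x <- explore n z s) weight x.1 * h x.2 = weight s * expect (D n) h.
Proof.
elim: n z s h => [|n IH] z s h z1; first by rewrite big_seq1 expect_law0.
rewrite big_cons big_map /= expect_lawS weight_cons.
rewrite (explore_list_weight (E := D n) (zs := children z) _ _ (fun us => h (join us))).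
  by rewrite weight_cons size_children //; ring.
by move=> y s' h' /child_neq1; exact: IH.
Qed.

Definition in_branch z : pred F := fun w => suffix (word z) (word w).

(** Records that no site is inspected twice, as [restrict_unit] requires. *)
Definition extends (B : pred F) s s' :=
  exists e, [/\ s' = e ++ s, uniq (unzip1 e) & all B (unzip1 e)].

Lemma extends_refl B s : extends B s s. Proof. by exists [::]. Qed.

Lemma branch_disjoint z y w : size (word z) = size (word y) ->
  in_branch z w -> in_branch y w -> z = y.
Proof.
move=> zy /suffixP[u uE] /suffixP[v vE]; apply: val_inj => /=.
have e : u ++ word z = v ++ word y by rewrite -uE -vE.
have := congr1 (drop (size u)) e; rewrite drop_size_cat // drop_size_cat //.
by have := congr1 size e; rewrite !size_cat zy => /addIn.
Qed.

(** Roots at the same depth span disjoint branches, so separate explorations never meet. *)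
Lemma explore_list_extends ex zs (l : nat) :
  uniq zs -> all (fun z => size (word z) == l) zs ->
  (forall z s x, z \in zs -> x \in ex z s -> extends (in_branch z) s x.1) ->
  forall s x, x \in explore_list ex zs s -> extends (fun w => has (in_branch^~ w) zs) s x.1.
Proof.
elim: zs => [|z zs IH] /= uz lz H s x; first by rewrite inE => /eqP ->; exact: extends_refl.
move: uz lz => /andP[zzs uzs] /andP[/eqP lz lzs].
move=> /explore_list_cons[x1 [y [/H]]]; rewrite mem_head => /(_ isT)[e1 [-> u1 b1]].
have {}IH := IH uzs lzs (fun y s x yz => H y s x (mem_behead (s := z :: zs) yz)).
move=> /IH[e2 [e2E u2 b2]] -> /=; exists (e2 ++ e1); rewrite e2E catA; split=> //.
  rewrite /unzip1 map_cat cat_uniq u1 u2 !andbT; apply/hasPn => w we1.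
  apply/negP => /(allP b2)/hasP[y' yzs wy'].
  have := allP b1 _ we1 => wz; move/negP: zzs; apply.
  by rewrite (branch_disjoint _ wz wy') // lz (eqP (allP lzs _ yzs)).
rewrite /unzip1 map_cat all_cat; apply/andP; split.
  by apply: sub_all b2 => w wb; rewrite /= wb orbT.
by apply: sub_all b1 => w wb; rewrite /= wb.
Qed.

Lemma children_uniq z : uniq (children z).
Proof.
rewrite map_inj_uniq; first exact/filter_uniq/enum_uniq.
by move=> c c' /mulIg/(congr1 (@word _)) [].
Qed.

Lemma children_size z : all (fun y => size (word y) == (size (word z)).+1) (children z).
Proof.
apply/allP => y /mapP[c]; rewrite mem_filter => /andP[bc _] ->.
by rewrite word_child.
Qed.

Lemma child_branch z y w : y \in children z -> in_branch y w -> in_branch z w && (w != z).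
Proof.
move=> yz /suffixP[u wE]; have := allP (children_size z) _ yz => /eqP ys.
move: yz => /mapP[c]; rewrite mem_filter => /andP[bc _] yE.
apply/andP; split.
  apply/suffixP; exists (rcons u c); rewrite wE yE word_child //.
  by rewrite cat_rcons.
apply: contraTneq isT => wz; have := congr1 size wE.
by rewrite wz size_cat ys => /eqP; rewrite eqn_leq addnS ltnNge leq_addl andbF.
Qed.

Lemma explore_extends n z s x : x \in explore n z s -> extends (in_branch z) s x.1.
Proof.
elim: n z s x => [|n IH] z s x /=; first by rewrite inE => /eqP ->; exact: extends_refl.
have zz : in_branch z z by exact: suffix_refl.
rewrite inE => /predU1P[->|/mapP[y yl ->]] /=.
  by exists [:: (z, false)]; rewrite /= zz.
have [e [-> ue be]] := explore_list_extends (children_uniq z) (children_size z)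
  (fun y s x _ => IH y s x) yl.
exists (rcons e (z, true)); rewrite cat_rcons /unzip1 map_rcons rcons_uniq ue andbT all_rcons.
split=> //.
  by apply/negP => /(allP be)/hasP[w wc /(child_branch wc)]; rewrite eqxx andbF.
rewrite /= zz; apply: sub_all be => w /hasP[u uc /(child_branch uc)] /andP[] //.
Qed.

Lemma explore_list_describes n z0 zs :
  (forall z s x, z \in zs -> (z0, true) \in s -> x \in explore n z s ->
     valid x.2 /\ describes x.1 z z0 x.2) ->
  forall s x, (z0, true) \in s -> x \in explore_list (explore n) zs s ->
    [/\ exists e, x.1 = e ++ s, all valid x.2 & describe_all x.1 z0 zs x.2].
Proof.
elim: zs => [|z zs IH] H s x sz /=; first by rewrite inE => /eqP ->; split=> //; exists [::].
move=> /explore_list_cons[x1 [y [x1s]]].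
have [v1 d1] := H z s x1 (mem_head _ _) sz x1s.
have [e1 [e1E _ _]] := explore_extends x1s.
have sz1 : (z0, true) \in x1.1 by rewrite e1E mem_cat sz orbT.
move=> /(IH _ _ _ sz1)[|[e eE] vy dy ->] /=.
  by move=> u s' x' uz; apply: H; rewrite in_cons uz orbT.
split; first by exists (e ++ e1); rewrite eE e1E catA.
  by rewrite v1.
by split => //; rewrite eE; exact: describes_cat.
Qed.

Lemma lampop_restrict_site s z : (z, true) \in s ->
  T (restrict s (site z)) =
  \sum_c restrict s (avg (letter_elt c * z)%g (site (letter_elt c * z)%g)).
Proof.
move=> zs; rewrite -restrict_conv; last exact: lampop_conv.
rewrite lampop_site // (lin_sum (restrict_linear s)); apply: eq_bigr => c _.
by rewrite lamp_avgC restrict_open.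
Qed.

Lemma parent_term s z c : (z, true) \in s -> word (letter_elt c * z)%g = c :: word z ->
  \sum_(b | backward (letter_elt c * z)%g b)
    restrict s (avg (letter_elt b * (letter_elt c * z))%g
                    (site (letter_elt b * (letter_elt c * z))%g)) =
  restrict s (site z).
Proof.
move=> zs cz; rewrite (big_pred1 (letter_inv c)) => [|b]; last by rewrite /backward cz.
by rewrite -letter_eltV mulKg restrict_open.
Qed.

(** Soundness of the messages: by induction on depth, the formulas of [join] are realised by the
    vectors from [node_ran] and [node_fin]. *)
Lemma explore_describes n z0 c s x : let z := (letter_elt c * z0)%g in
  word z = c :: word z0 -> (z0, true) \in s -> x \in explore n z s ->
  valid x.2 /\ describes x.1 z z0 x.2.
Proof.
elim: n z0 c s x => [|n IH] z0 c s x z zE sz /=; first by rewrite inE => /eqP ->.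
have Tl := is_conv_linear (lampop_conv R d m).
rewrite inE => /predU1P[->|/mapP[y yl ->]] /=.
  (* On a closed site the averaged point mass is killed, so zero vectors serve and the message is
     that of an absent vertex. *)
  split=> //; exists 0, 0; split=> //; rewrite (lin0 Tl); last by rewrite scale0r addr0.
  by rewrite -[RHS]/(restrict ((z, false) :: s) _) restrict_closed ?mem_head.
have [[e eE] vy dy] : [/\ exists e, y.1 = e ++ (z, true) :: s, all valid y.2 &
    describe_all y.1 z (children z) y.2].
  apply: explore_list_describes yl; last exact: mem_head.
  move=> u s' x' /mapP[b]; rewrite mem_filter => /andP[bz _] ->.
  by apply: IH; exact: word_child.
split; first exact: valid_join.
have zy : (z, true) \in y.1 by rewrite eE mem_cat mem_head orbT.
have z0y : (z0, true) \in y.1 by rewrite eE mem_cat in_cons sz !orbT.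
have z1 : z != 1%g by apply: contraTneq isT => /(congr1 (@word _)); rewrite zE.
have ou := off_unit_restrict y.1 (@off_unit_site R d m z z1).
have T_node := lampop_restrict_site zy.
rewrite (sum_children z (fun w => restrict y.1 (avg w (site w)))) in T_node.
rewrite (parent_term z0y zE) in T_node.
rewrite /join; case: ifP => // fin; case: ifP => ran /=.
  have [v [w [v0 w0 Tv Tw]]] := node_ran dy vy T_node ran.
  exists (((1 + \sum_(u <- y.2) rval u)^-1)%:C%C *: (restrict y.1 (site z) - v)), w.
  split=> //; first exact/off_unitZ/off_unitB.
  by rewrite Tw restrict_open.
have [v [w [v0 w0 Tv Tw]]] := node_fin dy vy T_node fin (negbT ran).
exists v, (((\sum_(u <- y.2) kval u)^-1)%:C%C *: (restrict y.1 (site z) - w)).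
split=> //; first exact/off_unitZ/off_unitB.
by rewrite Tv restrict_open.
Qed.

(** * The trace as a mean over explorations *)

Section Trace.
Variable P : l2 -> l2.
Hypothesis P_proj : orthogonal_projection (lamp_ker d m R) P.

Let T_linear := is_conv_linear (lampop_conv R d m).
Let P_linear : linear P := proj_linear T_linear P_proj.
Let x1 := site 1%g.

Let P_range f : P (T f) = 0.
Proof. exact: (proj_range T_linear P_proj (@lampop_sa R d m)). Qed.

Definition outcome_trace s : R := complex.Re (l2dot (P (restrict s x1)) x1).

Lemma outcome_traceP s : uniq (unzip1 s) ->
  l2dot (P (restrict s x1)) x1 = (outcome_trace s)%:C%C /\ 0 <= outcome_trace s <= weight s.
Proof.
move=> us.
have [r rE rb] := proj_sub_bounds T_linear P_proj (restrict_linear s)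
  (@restrict_sa R d m s) (@restrict_idem R d m s)
  (fun f => esym (restrict_conv s f (lampop_conv R d m))) x1.
have nE : nrm2 (restrict s x1) = weight s.
  apply: (@complexI R); rewrite -l2dotff -restrict_sa restrict_idem.
  by rewrite l2dot_point (restrict_unit R m_gt1).
by rewrite /outcome_trace rE /= -nE.
Qed.

Lemma outcome_trace_fin n (x : config * seq (msg R)) :
  x \in explore_list (explore n) (children 1%g) [:: (1%g, true)] ->
  uniq (unzip1 x.1) /\
  (all is_fin x.2 -> outcome_trace x.1 = weight x.1 * root_val x.2).
Proof.
move=> xl.
have ux : uniq (unzip1 x.1).
  have [e [-> ue be]] := explore_list_extends (children_uniq 1%g) (children_size 1%g)
    (fun y s x _ xs => @explore_extends n y s x xs) xl.
  rewrite /unzip1 map_cat cats1 rcons_uniq ue andbT.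
  by apply/negP => /(allP be)/hasP[w wc /(child_branch wc)]; rewrite eqxx andbF.
split=> // fin; have [[e eE] vy dy] : [/\ exists e, x.1 = e ++ [:: (1%g, true)],
    all valid x.2 & describe_all x.1 1%g (children 1%g) x.2].
  apply: explore_list_describes xl; last exact: mem_head.
  move=> u s' x' /mapP[b]; rewrite mem_filter => /andP[bz _] ->.
  by apply: explore_describes; exact: word_child.
have xx : (1%g, true) \in x.1 by rewrite eE mem_cat mem_head orbT.
have T_node := lampop_restrict_site xx.
(* The unit has no parent, so the term [par] is 0. *)
rewrite (sum_children 1%g (fun w => restrict x.1 (avg w (site w)))) big_pred0 // in T_node.
rewrite /outcome_trace /root_val; case: ifP => ran.
  have [v [w [v0 w0 Tv Tw]]] := node_ran dy vy T_node ran.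
  set t := (1 + _)^-1 in Tv Tw *.
  (* Kernel part plus range part: [P] fixes the first and kills the second, and [v] vanishes at the
     unit. *)
  have -> : restrict x.1 x1 = t%:C%C *: (restrict x.1 x1 - v) + T w.
    by rewrite Tw addrC subrK.
  rewrite (linD P_linear) P_range addr0 (proj_id T_linear P_proj); last by rewrite Tv scaler0.
  rewrite l2dotZl l2dotBl (off_unit_dot v0) subr0 l2dot_point restrict_unit //.
  by rewrite ReM /= mulr0 subr0 mulrC.
have [v [w [v0 w0 Tv Tw]]] := node_fin dy vy T_node fin (negbT ran).
by rewrite -/x1 -Tv P_range l2dot0l mulr0.
Qed.

Lemma trace_estimate n : exists2 r : R, vN_trace P = r%:C%C &
  `|r - (1 - p + p * root_mean p k n)| <= p * (1 - p_fin p k n ^+ k.+1).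
Proof.
pose L := explore_list (explore n) (children 1%g) [:: (1%g, true)].
(* If the unit is closed, its point mass lies in the kernel; this gives the summand [1 - p]. *)
have closed : P (restrict [:: (1%g, false)] x1) = restrict [:: (1%g, false)] x1.
  apply: (proj_id T_linear P_proj); rewrite /= -/(lampop _).
  change (T (restrict [:: (1%g, false)] x1) = 0).
  rewrite -restrict_conv; last exact: lampop_conv.
  rewrite lampop_site // (lin_sum (restrict_linear _)) big1 // => c _.
  by rewrite lamp_avgC restrict_closed ?mem_head.
have x1E : x1 = restrict [:: (1%g, false)] x1 + \sum_(x <- L) restrict x.1 x1.
  by rewrite (explore_list_sum _ (explore_sum _ _)) /= subrK.
exists (1 - p + \sum_(x <- L) outcome_trace x.1).
  have -> : vN_trace P = l2dot (P x1) x1.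
    by rewrite /vN_trace (_ : l2_delta R _ = x1) //; exact: l2_delta_point.
  rewrite {1}x1E (linD P_linear) closed l2dotDl l2dot_point.
  rewrite (restrict_unit R m_gt1) // {1}/weight big_seq1 /= [RHS]rmorphD; congr (_ + _).
  rewrite (lin_sum P_linear) l2dot_suml rmorph_sum big_seq [RHS]big_seq.
  apply: eq_bigr => x xL; have [ux _] := outcome_trace_fin xL.
  by have [-> _] := outcome_traceP ux.
have wE (h : seq (msg R) -> R) : \sum_(x <- L) weight x.1 * h x.2 = p * expect (iid (D n) k.+1) h.
  rewrite (explore_list_weight (E := D n)) => [|z s h' /child_neq1 z1].
    by rewrite size_children1 /weight big_seq1.
  exact: explore_weight.
have k0 : (0 < k)%N by rewrite subn_gt0; case: (d) d_gt0 => // j _; rewrite mulnS.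
have m1 : expect (iid (D n) k.+1) (fun=> 1) = 1.
  by apply: expect_iid1; exact: expect_law1.
have -> : p * (1 - p_fin p k n ^+ k.+1) =
    \sum_(x <- L) weight x.1 * (1 - (all is_fin x.2)%:R).
  by rewrite (wE (fun us => 1 - (all is_fin us)%:R)) expectB expect_all m1.
rewrite /root_mean -(wE (@root_val R)).
have -> (a b1 b2 : R) : a + b1 - (a + b2) = b1 - b2 by ring.
rewrite -sumrB; apply: le_trans (ler_norm_sum _ _ _) _.
rewrite big_seq [leRHS]big_seq; apply: ler_sum => x xL.
have [ux fin] := outcome_trace_fin xL; have [_] := outcome_traceP ux; move=> /andP[r0 r1].
have [af|nf] := boolP (all is_fin x.2).
  by rewrite fin // !subrr normr0 mulr0.
(* A cut-off outcome counts 0 in [root_mean], while its true contribution lies between 0 and its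
   weight. *)
have nran : all is_ran x.2 = false by apply: contraNF nf; exact: all_ran_fin.
by rewrite /root_val nran mulr0 !subr0 mulr1 ger0_norm.
Qed.

End Trace.

End Tree.

(** * The value of the dimension *)

Section Numbers.
Variables (R : realType) (d m : nat).
Hypotheses (d_gt0 : (0 < d)%N) (m_gt : (2 * d - 1 < m)%N).
Local Notation n := (2 * d - 1)%N.
Let p : R := m%:R^-1.

Lemma degreeE : (2 * d - 2 = n.-1)%N /\ (0 < n)%N.
Proof. by case: d d_gt0 => // e _; rewrite mulnS !subSS !subn0. Qed.

Lemma m_gt0R : 0 < m%:R :> R.
Proof. by rewrite ltr0n (leq_ltn_trans _ m_gt). Qed.

Lemma p_gt0R : 0 < p. Proof. by rewrite invr_gt0 m_gt0R. Qed.

Lemma p_subcritical : p * n%:R < 1.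
Proof. by rewrite mulrC ltr_pdivrMr ?m_gt0R // mul1r ltr_nat. Qed.

Definition tau_eq (t : R) : Prop := 0 < t /\ t ^+ n - t ^+ (2 * d - 2) = p.

Lemma tau_eqE (t : R) : t ^+ n - t ^+ (2 * d - 2) = t ^+ n.-1 * (t - 1).
Proof.
have [-> n0] := degreeE; rewrite -{1}(prednK n0) exprSr; ring.
Qed.

Lemma tau_gt1 t : tau_eq t -> 1 < t.
Proof.
move=> [t0]; rewrite tau_eqE => e; rewrite -subr_gt0.
by rewrite -(pmulr_rgt0 _ (exprn_gt0 n.-1 t0)) e p_gt0R.
Qed.

Lemma tau_exists : exists tau, unique tau_eq tau.
Proof.
have [e1 n0] := degreeE.
pose P : {poly R} := 'X^(n.-1) * ('X - 1) - p%:P.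
have PE t : P.[t] = t ^+ n.-1 * (t - 1) - p.
  by rewrite /P !hornerE.
(* The values at the endpoints are -p and 2^(n-1) - p. *)
have [||t /andP[t1 t2] /rootP Pt] := @poly_ivt R P 1 2.
- by rewrite ler1n.
- rewrite !PE subrr mulr0 sub0r oppr_le0 (ltW p_gt0R) /=.
  have -> : (2 : R) - 1 = 1 by ring.
  rewrite mulr1 subr_ge0 (@le_trans _ _ 1) ?exprn_ege1 ?ler1n //.
  by rewrite invf_le1 ?m_gt0R // ler1n -(ltr0n R) m_gt0R.
have tt : tau_eq t.
  split; first exact: lt_le_trans ltr01 t1.
  by rewrite tau_eqE; apply/subr0_eq; rewrite -PE.
exists t; split=> // u uu.
(* Every positive solution exceeds 1, where both factors are positive and t - 1 is strictly
   increasing. *)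
have key (x y : R) : tau_eq x -> tau_eq y -> x < y -> False.
  move=> xt yt xy; have x1 := tau_gt1 xt; have y1 := tau_gt1 yt.
  move: xt yt => [x0 ex] [y0 ey]; move: ex ey; rewrite !tau_eqE => ex ey.
  suff : x ^+ n.-1 * (x - 1) < y ^+ n.-1 * (y - 1) by rewrite ex ey ltxx.
  apply: (@le_lt_trans _ _ (y ^+ n.-1 * (x - 1))).
    by rewrite ler_wpM2r ?subr_ge0 ?(ltW x1) // lerXn2r ?nnegrE ?(ltW x0) ?(ltW y0) // ltW.
  by rewrite ltr_pM2l ?exprn_gt0 // ltrD2r.
by have [/key h|/key h|//] := ltgtP t u; case: h.
Qed.

Variable tau : R.
Hypothesis tauP : tau_eq tau.
Let tau1 : 1 < tau := tau_gt1 tauP.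
Let tau0 : tau != 0. Proof. by rewrite gt_eqF // (lt_trans ltr01). Qed.

Definition dim_value : R :=
  1 - 2 * p + (tau - 1) * (2 - 2 * d%:R + 2 * d%:R * tau) / tau ^+ 2.

Let sigma := tau^-1.

Lemma sigma_bounds : 0 < sigma < 1.
Proof. by rewrite invr_gt0 (lt_trans ltr01) //= invf_lt1 // (lt_trans ltr01). Qed.

Lemma sigma_eq : sigma ^+ n = m%:R * (1 - sigma).
Proof.
have [e1 n0] := degreeE; have [_] := tauP; rewrite tau_eqE => e.
have m0 : m%:R != 0 :> R by rewrite gt_eqF ?m_gt0R.
apply: (mulfI (invr_neq0 m0)); rewrite mulKf // -/p -e /sigma exprVn.
rewrite -{2}(prednK n0) exprSr; field.
by rewrite tau0 expf_neq0.
Qed.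

Definition alpha := 1 - sigma.

Lemma alpha_bounds : 0 <= alpha <= 1.
Proof. by have /andP[s0 s1] := sigma_bounds; rewrite /alpha; apply/andP; split; lra. Qed.

Lemma alpha_eq : alpha = p * (1 - alpha) ^+ n.
Proof.
rewrite /alpha subKr sigma_eq mulKf // gt_eqF ?m_gt0R //.
Qed.

Lemma n_nat : n%:R = 2 * d%:R - 1 :> R.
Proof. by rewrite natrB ?natrM // muln_gt0. Qed.

Lemma dim_alpha : dim_value = 1 - 2 * p + 2 * alpha + (2 * d%:R - 2) * alpha ^+ 2.
Proof. by rewrite /dim_value /alpha /sigma; field; exact: tau0. Qed.

(** The equation for [alpha] turns p (1 - alpha)^(n+1) into alpha (1 - alpha). *)
Lemma dim_limit : 1 - p + limit_dim p n alpha = dim_value.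
Proof.
have nE : n.+1%:R = 2 * d%:R :> R by rewrite -[n.+1%:R]natr1 n_nat; ring.
rewrite dim_alpha /limit_dim exprS nE.
have -> : 2 * p * ((1 - alpha) * (1 - alpha) ^+ n) =
    2 * (1 - alpha) * (p * (1 - alpha) ^+ n) by ring.
by rewrite -alpha_eq; ring.
Qed.

Section Irrational.
Hypothesis d_gt1 : (1 < d)%N.

Lemma sigma_irrational (q : rat) : ratr q != sigma.
Proof.
apply/eqP => qs; have /andP[s0 s1] := sigma_bounds; have := sigma_eq.
have [k kE] : exists k, n = k.+2.
  by exists (2 * (d - 1) - 1)%N; case: d d_gt1 => [|[|e]] //; rewrite !mulnS; lia.
rewrite -qs -(rmorph_nat (@ratr R)) -(rmorph1 (@ratr R)) -rmorphB -rmorphM -rmorphXn /=.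
move=> /(fmorph_inj (@ratr R)) e.
have q0 : 0 < q by rewrite -(ltr0q R) qs.
have q1 : q < 1 by rewrite -(ltr_rat R) rmorph1 qs.
have b0 : (denq q)%:Q != 0 by rewrite intr_eq0 denq_neq0.
have qE : q = (numq q)%:Q / (denq q)%:Q by rewrite divq_num_den.
(* Rational root argument: the denominator divides a power of the coprime numerator, so it is 1, and
   no integer lies strictly between 0 and 1. *)
have eZ : numq q ^+ n = denq q * (m%:Z * denq q ^+ k * (denq q - numq q)).
  apply: (@intr_inj rat); rewrite rmorphXn /= !rmorphM /= rmorphB /= rmorphXn /=.
  move: e; rewrite {1 2}qE expr_div_n kE => /(congr1 (fun x => x * (denq q)%:Q ^+ k.+2)).
  rewrite divfK ?expf_neq0 // => ->; rewrite !exprS; field.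
  exact: b0.
have : (`|denq q| %| `|numq q| ^ n)%N.
  by rewrite -abszX eZ abszM dvdn_mulr.
have cop : coprime `|denq q| (`|numq q| ^ n) by rewrite coprimeXr // coprime_sym coprime_num_den.
move=> /gcdn_idPl; rewrite (eqP cop) => b1.
have d1 : denq q = 1 by rewrite -(absz_denq q) -b1.
have qz : q = (numq q)%:Q by rewrite {1}qE d1 divr1.
move: q0 q1; rewrite qz ltr0z ltrz1; lia.
Qed.

Lemma dim_irrational : irrational dim_value.
Proof.
move=> [r _ rE]; have [e1 n0] := degreeE; have /andP[s0 s1] := sigma_bounds.
have d1 : 0 < 2 * d%:R - 2 :> R by rewrite subr_gt0 -[X in X < _]mulr1 ltr_pM2l ?ltr1n.
have d1n : (2 * d%:R - 2 : rat) != 0.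
  by rewrite subr_eq0 -[X in _ == X]mulr1 (inj_eq (mulfI _)) // pnatr_eq1 gtn_eqF.
(* Expanding [dim_alpha] in sigma gives sigma^2 = u sigma + v, where [v] is rational because the
   dimension is assumed to be. *)
pose u : rat := (2 * n%:R) / (2 * d%:R - 2).
pose v : rat := (r - 2 * d%:R - 1 + 2 / m%:R) / (2 * d%:R - 2).
have uE : ratr u = 2 * n%:R / (2 * d%:R - 2) :> R.
  by rewrite /u fmorph_div rmorphB /= !rmorphM /= !rmorph_nat.
have vE : ratr v = (dim_value - 2 * d%:R - 1 + 2 * p) / (2 * d%:R - 2) :> R.
  rewrite /v fmorph_div /= !rmorphD /= !rmorphN /= fmorph_div /= rE.
  by rewrite !rmorphM /= !rmorph_nat rmorph1.
clearbody u v.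
have quad : sigma ^+ 2 = ratr u * sigma + ratr v.
  rewrite uE vE dim_alpha /alpha n_nat; field.
  by rewrite gt_eqF.
pose s' := ratr u - sigma.
have quad' : s' ^+ 2 = ratr u * s' + ratr v.
  have -> : ratr v = sigma ^+ 2 - ratr u * sigma by rewrite quad addrC addKr.
  by rewrite /s'; ring.
have s'1 : 1 < s'.
  have : 2 < ratr u :> R by rewrite uE n_nat ltr_pdivlMr //; lra.
  by rewrite /s'; lra.
(* Reduction modulo the quadratic uses the same rational coefficients for both of its roots. *)
have pw j : exists a b : rat, sigma ^+ j = ratr a * sigma + ratr b /\
    s' ^+ j = ratr a * s' + ratr b.
  elim: j => [|j [a [b [ea eb]]]].
    by exists 0, 1; rewrite !expr0 rmorph0 rmorph1 !mul0r !add0r.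
  exists (a * u + b), (a * v); rewrite !exprSr ea eb rmorphD /= !rmorphM /=.
  have st (x : R) : x ^+ 2 = ratr u * x + ratr v ->
      (ratr a * x + ratr b) * x = (ratr a * ratr u + ratr b) * x + ratr a * ratr v.
    move=> xx; have -> : (ratr a * x + ratr b) * x = ratr a * x ^+ 2 + ratr b * x by ring.
    by rewrite xx; ring.
  by rewrite (st _ quad) (st _ quad').
have [a [b [ea eb]]] := pw n.
have lin : ratr (a + m%:R) * sigma = ratr (m%:R - b) :> R.
  rewrite rmorphD rmorphB /= rmorph_nat.
  by have := sigma_eq; rewrite ea; lra.
(* Otherwise sigma would be rational. So a = -m and b = m, and the conjugate satisfies s'^n = m (1 -
   s'), which is negative. *)
have am : a + m%:R = 0.
  apply/eqP; apply: contraT => am0.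
  have := sigma_irrational ((m%:R - b) / (a + m%:R)).
  by rewrite fmorph_div /= -lin mulrC mulKf ?eqxx // fmorph_eq0.
have bm : b = m%:R.
  move: lin; rewrite am rmorph0 mul0r => /esym/eqP; rewrite fmorph_eq0 subr_eq0.
  by move=> /eqP.
have aE : a = - m%:R by apply/eqP; rewrite -addr_eq0 am.
have : 0 < s' ^+ n by rewrite exprn_gt0 // (lt_trans ltr01).
rewrite eb aE bm rmorphN /= rmorph_nat.
have := m_gt0R; nra.
Qed.

End Irrational.

Lemma sigma_algebraic : algebraicOver (@ratr R) sigma.
Proof.
have [e1 n0] := degreeE.
exists ('X^n + (m%:R)%:P * 'X - (m%:R)%:P).
  apply/eqP => /(congr1 (fun q : {poly rat} => q.[0])); rewrite !hornerE.
  rewrite expr0n gtn_eqF //= add0r => /eqP; rewrite oppr_eq0 pnatr_eq0.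
  by rewrite gtn_eqF // -(ltr0n R) m_gt0R.
rewrite rmorphB rmorphD rmorphM /= map_polyXn map_polyX map_polyC /= rmorph_nat.
by apply/rootP; rewrite !hornerE sigma_eq; ring.
Qed.

Lemma dim_algebraic : algebraicOver (@ratr R) dim_value.
Proof.
have nat_alg j : algebraicOver (@ratr R) (j%:R : R).
  by rewrite -(rmorph_nat (@ratr R)); exact: algebraic_id.
have tau_alg : algebraicOver (@ratr R) tau.
  by rewrite -[tau]invrK; apply: algebraic_inv; exact: sigma_algebraic.
rewrite /dim_value /p expr2.
do ?[apply: algebraic_add | apply: algebraic_sub | apply: algebraic_mul |
     apply: algebraic_inv | exact: nat_alg | exact: tau_alg |
     apply: algebraic_opp | exact: (nat_alg 1%N)].
Qed.

End Numbers.

Lemma lamplighter_dim (R : realType) (d m : nat) (tau : R) :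
  (0 < d)%N -> (2 * d - 1 < m)%N -> tau_eq d m tau ->
  has_vN_dim (lamp_ker d m R) (dim_value d m tau).
Proof.
move=> d0 dm tauP.
have k0 : (0 < 2 * d - 1)%N := (degreeE d0).2.
have m1 : (1 < m)%N by exact: leq_ltn_trans k0 dm.
have [c c0 Tc] := is_conv_bounded (lampop_conv R d m).
have [P [vnP P_proj]] :=
  kernel_projection (lampop_conv R d m) (@lampop_sa R d m) c0 Tc.
exists P; split=> //.
(* Depth 0 only supplies that the trace is a real number [r]; its value comes from estimates at
   large depth. *)
have [r rE _] := trace_estimate d0 m1 P_proj 0.
rewrite rE; congr (_%:C)%C; apply/subr0_eq/eqP.
rewrite -normr_eq0 eq_le normr_ge0 andbT; apply/ler_addgt0Pr => e e0; rewrite add0r.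
have e2 : 0 < e / 2 by rewrite divr_gt0.
have [n [n1 n2]] := root_mean_cvg (p_gt0R R dm) k0 (p_subcritical R dm)
  (alpha_eq d0 dm tauP) (alpha_bounds d0 dm tauP) e2.
have [r' r'E r'n] := trace_estimate d0 m1 P_proj n.
have -> : r = r' by apply: (@complexI R); rewrite -rE.
move: (le_trans r'n n2); rewrite -(dim_limit d0 dm tauP).
move: n1; rewrite !ler_norml; lra.
Qed.

Lemma powR_invnK (R : realType) (a : R) (n : nat) :
  (0 < n)%N -> 0 < a -> (a `^ n%:R^-1) ^+ n = a.
Proof.
move=> n0 a0; rewrite -powR_mulrn ?powR_ge0 // -powRrM mulVf ?powRr1 ?(ltW a0) //.
by rewrite pnatr_eq0 gtn_eqF.
Qed.

(** * The case d = 2, m = 4 *)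

Section Example.
Variable R : realType.

Let c : R := (766 + 258 * Num.sqrt 129) `^ 3^-1.
Let y : R := c - 200 / c.

Let sqrt129 : Num.sqrt 129 ^+ 2 = 129 :> R.
Proof. by rewrite sqr_sqrtr. Qed.

Let base_gt0 : 0 < 766 + 258 * Num.sqrt 129 :> R.
Proof. by have := sqrtr_ge0 (129 : R); lra. Qed.

Let c_gt0 : 0 < c. Proof. exact: powR_gt0. Qed.

Let c3 : c ^+ 3 = 766 + 258 * Num.sqrt 129.
Proof. exact: powR_invnK. Qed.

(** Cardano's formula: 258^2 * 129 - 766^2 = 200^3, so 200^3 / c^3 = 258 sqrt(129) - 766. *)
Let y_cubic : y ^+ 3 + 600 * y = 1532.
Proof.
have c0 : c != 0 by rewrite gt_eqF.
have -> : y ^+ 3 + 600 * y = c ^+ 3 - 200 ^+ 3 / c ^+ 3 by rewrite /y; field.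
have b0 : 766 + 258 * Num.sqrt 129 != 0 :> R by rewrite gt_eqF.
rewrite c3; apply: (mulIf b0); rewrite mulrBl divfK //.
have := sqrt129; set s := Num.sqrt 129 => s2.
have -> : (766 + 258 * s) * (766 + 258 * s) = 766 ^+ 2 + 2 * 766 * 258 * s + 258 ^+ 2 * s ^+ 2.
  by ring.
by rewrite s2; ring.
Qed.

Let cubic_lt (a b : R) : a < b -> a ^+ 3 + 600 * a < b ^+ 3 + 600 * b.
Proof.
move=> ab; rewrite -subr_gt0.
have -> : b ^+ 3 + 600 * b - (a ^+ 3 + 600 * a) =
    (b - a) * ((a + b / 2) ^+ 2 + 3 / 4 * b ^+ 2 + 600) by field.
have := sqr_ge0 (a + b / 2); have := sqr_ge0 b.
by move=> h1 h2; apply: mulr_gt0; lra.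
Qed.

Let cubic_inj (a b : R) : a ^+ 3 + 600 * a = b ^+ 3 + 600 * b -> a = b.
Proof.
by move=> ab; have [/cubic_lt|/cubic_lt|//] := ltgtP a b; rewrite ab ltxx.
Qed.

Lemma example_value : 2 * y / 3 - 5 / 6 = - (5 / 6) - 400 / (3 * c) + 2 * c / 3.
Proof. by rewrite /y; field; rewrite gt_eqF. Qed.

(* With sigma = 1/tau, a root of x^3 + 4x - 4, both y and 8 - 9 sigma + 3 sigma^2
   are the real root of x^3 + 600x - 1532. *)
Lemma example_dim (tau : R) : tau_eq 2 4 tau -> dim_value 2 4 tau = 2 * y / 3 - 5 / 6.
Proof.
move=> tauP; have tau0 : tau != 0 by rewrite gt_eqF //; case: tauP.
have s3 := @sigma_eq R 2 4 isT isT tau tauP.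
have -> : dim_value 2 4 tau = 1 / 2 + 2 * (1 - tau^-1) + 2 * (1 - tau^-1) ^+ 2.
  by rewrite (@dim_alpha R 2 4 isT isT tau tauP) /alpha; field.
have {}s3 : tau^-1 ^+ 3 = 4 * (1 - tau^-1) by exact: s3.
have yE : y = 8 - 9 * tau^-1 + 3 * tau^-1 ^+ 2.
  apply: cubic_inj; rewrite y_cubic; move: s3; set x := tau^-1 => x3.
  (* The last factor is the quotient in the polynomial division by x^3 + 4x - 4. *)
  have -> : (8 - 9 * x + 3 * x ^+ 2) ^+ 3 + 600 * (8 - 9 * x + 3 * x ^+ 2) =
     1532 + (x ^+ 3 - 4 * (1 - x)) * (27 * x ^+ 3 - 243 * x ^+ 2 + 837 * x - 945).
    by ring.
  by rewrite x3 subrr mul0r addr0.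
by rewrite yE; field.
Qed.

Lemma example_bound :
  `|2 * y / 3 - 5 / 6 - (850 * 10 ^+ 3 + 971) / 10 ^+ 6| < 5 / 10 ^+ 7 :> R.
Proof.
(* The two fractions enclose [y] closely enough for the sixth decimal of the dimension; the
   increasing cubic reduces each comparison to rational arithmetic. *)
have y1 : 6637 / 2627 < y.
  rewrite ltNge; apply/negP; rewrite le_eqVlt => /predU1P[e|/cubic_lt];
    [have := y_cubic; rewrite e | rewrite y_cubic]; lra.
have y2 : y < 3772 / 1493.
  rewrite ltNge; apply/negP; rewrite le_eqVlt => /predU1P[e|/cubic_lt];
    [have := y_cubic; rewrite -e | rewrite y_cubic]; lra.
rewrite ltr_norml; apply/andP; split; lra.
Qed.

End Example.

Theorem theorem2p3 (R : realType) :
  (forall d m : nat, (1 <= d)%N -> (2 * d - 1 < m)%N ->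
    let p : R := m%:R^-1 in
    exists tau : R,
      let dim : R :=
        1 - 2 * p + (tau - 1) * (2 - 2 * d%:R + 2 * d%:R * tau) / tau ^+ 2 in
      [/\ unique (fun t : R =>
            0 < t /\ t ^+ (2 * d - 1) - t ^+ (2 * d - 2) = p) tau,
          has_vN_dim (lamp_ker d m R) dim
        & (1 < d)%N -> irrational dim /\ algebraicOver (@ratr R) dim])
  /\ let c : R := (766 + 258 * Num.sqrt 129) `^ 3^-1 in
     let dim : R := - (5 / 6) - 400 / (3 * c) + 2 * c / 3 in
     has_vN_dim (lamp_ker 2 4 R) dim
     /\ `|dim - (850 * 10 ^+ 3 + 971) / 10 ^+ 6| < 5 / 10 ^+ 7.
Proof.
split=> [d m d0 dm p|c dim].
  have [tau [tauP tau_unique]] := tau_exists R d0 dm.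
  exists tau => dim; split; first by split.
    exact: lamplighter_dim.
  move=> d1; split; first exact: dim_irrational.
  exact: dim_algebraic.
have [tau [tauP _]] := @tau_exists R 2 4 isT isT.
rewrite /dim /c -example_value; split; last exact: example_bound.
by rewrite -(example_dim tauP); exact: lamplighter_dim.
Qed.
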